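(* Let $I$ be a compact interval and let $f:I\to I$ be a multimodal map whose set of periods is $P(f)=\{2^n : n\in\mathbb{N}\}=\{1,2,4,\dots\}$. Assume that $f$ has no wandering intervals, no plateaus, and no more than finitely many periodic attractors. Then $f$ is infinitely renormalizable.
   Context: $\mathbb{N}$ includes $0$. A point $x$ is a periodic point of period $n\ge1$ of $f$ if $f^n(x)=x$ and $f^i(x)\neq x$ for $0<i<n$; its orbit is a periodic orbit. $P(f)$ is the set of periods of all periodic points of $f$. Multimodal maps. Let $I=[c_0,c_{d+1}]$, $d\ge0$. A continuous map $f:I\to I$ is $d$-modal (multimodal with modality $d$) if there are points $c_0<c_1<\dots<c_{d+1}$ such that $f$ is monotone on each lap $[c_j,c_{j+1}]$, $0\le j\le d$, and not monotone on any segment $[c_j,c_{j+2}]$. For $1\le i\le d$, the maximal interval $[a_i,b_i]$ containing $c_i$ on which $f$ is constant is called a turning interval; it is called a plateau if $a_i<b_i$, and a turning point if $a_i=b_i$. Periodic attractors. A periodic point $x$ of period $n$ is attracting (resp. one-sided attracting) if there is a neighborhood (resp. one-sided neighborhood) $U$ of $x$ such that for every $y\in U$, $f^{nl}(y)\to x$ as $l\to\infty$. In both cases the orbit of $x$ is called a periodic attractor. Wandering intervals. An open interval $J\subset I$ is a wandering interval of $f$ if (1) $f^n(J)\cap f^m(J)=\emptyset$ for all $n\neq m$ in $\mathbb{N}$, and (2) $f^n(J)$ does not converge to a periodic orbit as $n\to\infty$. Renormalization. $f:I\to I$ is renormalizable if there exist a proper subinterval $J$ of $I$ and a positive integer $p$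 such that (1) the intervals $f^i(J)$, $i=0,1,\dots,p-1$, have pairwise disjoint interiors, and (2) $f^p(J)\subset J$; then $f^p|_J:J\to J$ is called a renormalization of $f$. $f$ is infinitely renormalizable if there exist an infinite sequence $\{I_n\}_{n\ge1}$ of nested intervals and an infinite sequence $\{u(n)\}_{n\ge1}$ of integers such that each $f^{u(n)}|_{I_n}:I_n\to I_n$ is a renormalization of $f$ and the length of $I_n$ tends to zero as $n\to\infty$. *)

(* Defs.v *)
(* MathComp-Analysis *)
From mathcomp Require Import all_boot all_order all_algebra.
From mathcomp Require Import all_classical all_reals all_analysis.

Set Implicit Arguments.
Unset Strict Implicit.
Unset Printing Implicit Defensive.

Import Order.TTheory GRing.Theory Num.Theory numFieldNormedType.Exports.

Local Open Scope classical_set_scope.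
Local Open Scope ring_scope.

(* A self-map of I = [a, b] is represented by a total f : R -> R; its values
   outside `[a, b] are irrelevant to every notion below. *)

(* Monotone in the weak sense: constancy on subintervals is allowed. *)
Definition monotone_on (R : realType) (f : R -> R) (u v : R) : Prop :=
  {in `[u, v] &, {homo f : x y / x <= y}} \/
  {in `[u, v] &, {homo f : x y /~ x <= y}}.

(* f is d-modal on [a, b] with cut points a = c 0 < ... < c d.+1 = b; only the
   values of c at indices at most d.+1 matter. *)
Definition modal (R : realType) (a b : R) (d : nat) (c : nat -> R)
    (f : R -> R) : Prop :=
  [/\ {within `[a, b], continuous f},
      {homo f : x / x \in `[a, b]},
      [/\ c 0%N = a, c d.+1 = b &
          forall j, (j <= d)%N -> c j < c j.+1],
      forall j, (j <= d)%N -> monotone_on f (c j) (c j.+1) &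
      forall j, (j < d)%N -> ~ monotone_on f (c j) (c j.+2)].

Definition const_interval (R : realType) (a b : R) (f : R -> R)
    (x l r : R) : Prop :=
  [/\ x \in `[l, r], `[l, r] `<=` `[a, b] &
      {in `[l, r] &, forall y z, f y = f z}].

Definition turning_interval (R : realType) (a b : R) (d : nat)
    (c : nat -> R) (f : R -> R) (l r : R) : Prop :=
  exists i, [/\ (1 <= i <= d)%N,
    const_interval a b f (c i) l r &
    forall l' r', const_interval a b f (c i) l' r' ->
      `[l, r] `<=` `[l', r'] -> l' = l /\ r' = r].

Definition plateau (R : realType) (a b : R) (d : nat) (c : nat -> R)
    (f : R -> R) (l r : R) : Prop :=
  turning_interval a b d c f l r /\ l < r.

Definition periodic_point (R : realType) (a b : R) (f : R -> R) (n : nat)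
    (x : R) : Prop :=
  [/\ (0 < n)%N, x \in `[a, b], iter n f x = x &
      forall i, (0 < i < n)%N -> iter i f x <> x].

Definition periods (R : realType) (a b : R) (f : R -> R) : set nat :=
  [set n | exists x, periodic_point a b f n x].

Definition forward_orbit (R : realType) (f : R -> R) (x : R) : set R :=
  range (fun k => iter k f x).

Definition attracted (R : realType) (f : R -> R) (n : nat) (x y : R) : Prop :=
  (fun l => iter (n * l) f y) @ \oo --> x.

(* Neighborhoods are relative to [a, b]. *)
Definition attracting (R : realType) (a b : R) (f : R -> R) (n : nat)
    (x : R) : Prop :=
  periodic_point a b f n x /\
  \forall y \near within `[a, b] (nbhs x), attracted f n x y.

(* The conditions x < b and a < x rule out the degenerate one-sided
   neighborhood {x} at an endpoint of [a, b]. *)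
Definition one_sided_attracting (R : realType) (a b : R) (f : R -> R)
    (n : nat) (x : R) : Prop :=
  periodic_point a b f n x /\
  ((x < b /\ \forall y \near x^'+, attracted f n x y) \/
   (a < x /\ \forall y \near x^'-, attracted f n x y)).

Definition periodic_attractors (R : realType) (a b : R) (f : R -> R) :
    set (set R) :=
  [set A | exists n x, A = forward_orbit f x /\
    (attracting a b f n x \/ one_sided_attracting a b f n x)].

(* The sets F n are eventually inside every e-neighborhood of A. *)
Definition sets_converge_to (R : realType) (F : nat -> set R) (A : set R) :
    Prop :=
  forall e : R, 0 < e ->
    \forall n \near \oo, forall y, F n y -> exists2 z, A z & `|y - z| < e.

Definition wandering_interval (R : realType) (a b : R) (f : R -> R)
    (u v : R) : Prop :=
  [/\ u < v, `]u, v[ `<=` `[a, b],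
      trivIset setT (fun n => iter n f @` `]u, v[) &
      forall n x, periodic_point a b f n x ->
        ~ sets_converge_to (fun n => iter n f @` `]u, v[) (forward_orbit f x)].

(* f ^ p restricted to J = [l, r] is a renormalization of f; J is compact and
   nondegenerate, like I. *)
Definition renormalization (R : realType) (a b : R) (f : R -> R) (p : nat)
    (l r : R) : Prop :=
  [/\ l < r, `[l, r] `<` `[a, b], (0 < p)%N,
      trivIset `I_p (fun i => (iter i f @` `[l, r])°) &
      iter p f @` `[l, r] `<=` `[l, r]].

Definition infinitely_renormalizable (R : realType) (a b : R) (f : R -> R) :
    Prop :=
  exists (l r : nat -> R) (u : nat -> nat),
    [/\ forall n, renormalization a b f (u n) (l n) (r n),
        forall n, `[l n.+1, r n.+1] `<=` `[l n, r n] &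
        (fun n => r n - l n) @ \oo --> (0 : R)].

(* Main.v *)
Require Import Defs.
From mathcomp Require Import all_boot all_order all_algebra.
From mathcomp Require Import all_classical all_reals all_analysis.
From mathcomp Require Import lra zify.

Set Implicit Arguments.
Unset Strict Implicit.
Unset Printing Implicit Defensive.

Import Order.TTheory GRing.Theory Num.Theory numFieldNormedType.Exports.

Local Open Scope classical_set_scope.
Local Open Scope ring_scope.

(** Why the theorem holds. Suppose that f is not infinitely renormalizable; a
    wandering interval will be found.

    Since all periods are powers of 2, no iterate of f has a point of period 3,
    hence no iterate has a horseshoe (horseshoe_period3). So every periodic
    orbit of period at least 2, of f or of one of its iterates g, is cut by a
    fixed point z of g into two halves that g exchanges (division); and the hull
    of the left half never reaches z under iteration (avoid_fixed_point), so
    that its images under even iterates span an interval mapped to itself by g^2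
    and separated by z from its image (invariant_half).
    Applied to g = f, f^2, f^4, ... in turn, this gives inside [a, b] a cyclic
    interval J of period 2^n, that is, one whose first 2^n images have disjoint
    interiors and whose image number 2^n lies in J, containing a point of any
    prescribed larger period 2^k (cyclic_interval_orbit). With k = n + 2 the
    return map of J is not monotone, because a monotone self-map of an interval
    has no point of period 4; hence one of the images of J has a turning point in
    its interior (cyclic_interval_turning). There are finitely many turning
    points, so one of them is interior to cyclic intervals of period 2^n for
    infinitely many n, and intersecting these gives a nested sequence
    (nested_cyclic_intervals).

    If the lengths of the nested intervals tended to 0, these would be the
    renormalizations. Otherwise their intersection [u, v] is nondegenerate, and
    its images under all iterates have disjoint interiors. Its interior is
    wandering (limit_interval_wandering), for otherwise two images of it would
    share an end, or they would converge to a periodic orbit, and in both cases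
    an orbit would be attracted by a periodic point x without ever reaching it.
    But then, as f is monotone on either side of x, the hulls of x and of the
    tails of that orbit are mapped to themselves by the return map of x, and
    these intervals, which shrink to x, are renormalizations of constant period
    (attracted_orbit). The same trivial renormalizations exclude that an iterate
    collapses an interval onto a periodic point (no_collapse), which is how flat
    pieces of f are dealt with. *)

(** * Coverings of intervals and horseshoes *)

Section Horseshoe.
Variable R : realType.
Implicit Types (h : R -> R) (x y t u v : R).

(** An iterate may reverse the order of the ends of an interval; intervals are
    therefore given by two points in unknown order. *)
Definition between x y t := (x <= t <= y) || (y <= t <= x).

Lemma betweenC x y t : between x y t = between y x t.
Proof. by rewrite /between orbC. Qed.

Lemma continuous_iter h n : continuous h -> continuous (iter n h).
Proof.
move=> hc; elim: n => [|n ih] t; first exact: cvg_id.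
by apply: (@continuous_comp _ _ _ (iter n h) h); [exact: ih|exact: hc].
Qed.

Lemma between_ivt h x y v : continuous h -> between (h x) (h y) v ->
  exists2 t, between x y t & h t = v.
Proof.
move=> hc; wlog le_xy : x y / x <= y => [wl bv|].
  have [le_xy|/ltW le_yx] := leP x y; first exact: wl.
  by rewrite betweenC in bv; have [t tb ht] := wl y x le_yx bv;
    exists t; rewrite // betweenC.
move=> bv.
have hcw : {within `[x, y], continuous h} by exact: continuous_subspaceT.
have [|t txy ht] := @IVT R h x y v le_xy hcw.
  by unfold between in bv; case: (leP (h x) (h y)); lra.
by exists t => //; move: txy; rewrite in_itv /between /= => ->.
Qed.

Lemma first_hit h x y v : continuous h -> h x <= v <= h y ->
  exists t, [/\ between x y t, h t = v &
    forall s, between x t s -> h s <= v].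
Proof.
wlog le_xy : h x y / x <= y => [wl hc hv|hc hv].
  have [le_xy|/ltW le_yx] := leP x y; first exact: wl.
  have hNc : continuous (h \o -%R).
    by move=> s; apply: continuous_comp; [exact: opp_continuous|exact: hc].
  have [||t [tb ht tmin]] := wl (h \o -%R) (- x) (- y) _ hNc.
  - by rewrite lerN2.
  - by rewrite /= !opprK.
  exists (- t); split => //; first by unfold between in *; lra.
  move=> s sb; rewrite -(opprK s); apply: (tmin (- s)).
  by unfold between in *; lra.
pose E := `[x, y] `&` [set t | v <= h t].
have Ecpt : compact E.
  apply: (@subclosed_compact _ _ `[x, y]); last by move=> ? [].
    apply: closedI; first exact: itv_closed.
    have /continuous_closedP/(_ _ (@closed_ge _ v)) := hc; exact.
  exact: segment_compact.
have E0 : E !=set0.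
  by exists y; split; rewrite /= ?in_itv/= ?le_xy ?lexx //; case/andP: hv.
have [|t tE tmin] := @compact_EVT_min _ _ id E E0 Ecpt.
  by apply: continuous_subspaceT => ?; exact: cvg_id.
rewrite inE in tE; case: tE; rewrite /= in_itv /= => txy vt.
have below s : x <= s < t -> h s < v.
  move=> sxt; rewrite ltNge; apply/negP => vs.
  have : s \in E by rewrite inE; split; rewrite //= in_itv /=; lra.
  by move/tmin => /=; lra.
have htv : h t = v.
  have [|s sb hs] := @between_ivt h x t v hc; first by rewrite /between; lra.
  have [st|ts] := ltP s t; last first.
    by rewrite -hs; congr h; unfold between in *; lra.
  have := below s; rewrite hs ltxx => absurd.
  by suff: false by []; apply: absurd; unfold between in *; lra.
exists t; split => //; first by rewrite /between txy.
move=> s sb; have [st|ts] := ltP s t.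
  by apply/ltW/below; unfold between in sb; lra.
by rewrite (_ : s = t) ?htv //; unfold between in sb; lra.
Qed.

Lemma sorted_ends x y : exists lo hi, [/\ lo <= hi,
  (forall t, between x y t = (lo <= t <= hi)) &
  (lo = x /\ hi = y) \/ (lo = y /\ hi = x)].
Proof.
wlog le_xy : x y / x <= y => [wl|].
  have [le_xy|/ltW le_yx] := leP x y; first exact: wl.
  have [lo [hi [le_lohi lohiP lohi_eq]]] := wl _ _ le_yx.
  by exists lo, hi; split; [|move=> t; rewrite betweenC|tauto].
exists x, y; split; [by []| |by left].
by move=> t; apply/idP/idP; unfold between; lra.
Qed.

Lemma between_within u v x y t : u <= x <= v -> u <= y <= v ->
  between x y t -> u <= t <= v.
Proof. by rewrite /between; lra. Qed.

Lemma between_trans x y s t z : between x y s -> between x y t ->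
  between s t z -> between x y z.
Proof. by rewrite /between; lra. Qed.

Lemma no_turn x y z : y <> x -> z <> y ->
    (forall t, between x y t -> between y z t -> t = y) ->
  x < y < z \/ z < y < x.
Proof.
rewrite /between => /eqP + /eqP + joint; rewrite !neq_lt => xy yz.
have := joint x; have := joint z.
by case/orP: xy => xy; case/orP: yz => yz Hz Hx; try (left; lra); try (right; lra).
Qed.

(** Exactness is what lets such coverings be chained backwards without leaving
    a prescribed itinerary. On the way from x to y, e2 is the first visit to
    the level d and e1 the last visit to the level c before it. *)
Lemma exact_cover h x y c d : continuous h -> h x <= c -> c <= d -> d <= h y ->
  exists e1 e2, [/\ between x y e1, between x y e2, h e1 = c, h e2 = d &
    forall t, between e1 e2 t -> c <= h t <= d].
Proof.
move=> hc hxc cd dhy.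
have [|e2 [e2b he2 up]] := @first_hit h x y d hc; first by lra.
have hNc : continuous (-%R \o h).
  by move=> s; apply: continuous_comp; [exact: hc|exact: opp_continuous].
have [|e1 [e1b he1 dn]] := @first_hit (-%R \o h) e2 x (- c) hNc.
  by rewrite /=; lra.
rewrite /= in he1 dn.
exists e1, e2; split => //; try lra; try by unfold between in *; lra.
move=> t tb; have := dn t; have := up t.
by unfold between in *; lra.
Qed.

(** Call the two intervals A and B. Pulling A back exactly, first to B, then to
    A and again to A, gives a subinterval of A that h^3 maps onto A, hence a
    fixed point of h^3 with itinerary A, A, B; if h fixed it too, it would lie
    in both A and B. *)
Lemma horseshoe_period3 h x1 y1 x2 y2 u v : continuous h -> u <= v ->
  (forall t, between x1 y1 t -> u <= t <= v) ->
  (forall t, between x2 y2 t -> u <= t <= v) ->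
  h x1 <= u -> v <= h y1 -> h x2 <= u -> v <= h y2 ->
  (forall t, between x1 y1 t -> between x2 y2 t -> h t <> t) ->
  exists x, iter 3 h x = x /\ h x <> x.
Proof.
move=> hc uv A_uv B_uv hx1 hy1 hx2 hy2 AB.
have [lo [hi [le_lohi lohiP lohi_eq]]] := sorted_ends x1 y1.
have [lob hib] : between x1 y1 lo /\ between x1 y1 hi by rewrite !lohiP; lra.
have [||b1 [b2 [b1B b2B hb1 hb2 BA]]] := @exact_cover h x2 y2 lo hi hc _ le_lohi _.
- by have := A_uv _ lob; lra.
- by have := A_uv _ hib; lra.
have [bl [bh [le_blbh blbhP beq]]] := sorted_ends b1 b2.
have [blb bhb] : between b1 b2 bl /\ between b1 b2 bh by rewrite !blbhP; lra.
have B'B t : between b1 b2 t -> between x2 y2 t := between_trans b1B b2B.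
have [||a1 [a2 [a1A a2A ha1 ha2 AB']]] := @exact_cover h x1 y1 bl bh hc _ le_blbh _.
- by have := B_uv _ (B'B _ blb); lra.
- by have := B_uv _ (B'B _ bhb); lra.
have A'A t : between a1 a2 t -> between x1 y1 t := between_trans a1A a2A.
have [al [ah [le_alah alahP aeq]]] := sorted_ends a1 a2.
have [alb ahb] : between a1 a2 al /\ between a1 a2 ah by rewrite !alahP; lra.
have [||e1 [e2 [e1A e2A he1 he2 AA']]] := @exact_cover h x1 y1 al ah hc _ le_alah _.
- by have := A_uv _ (A'A _ alb); lra.
- by have := A_uv _ (A'A _ ahb); lra.
have h3c : continuous (fun t => iter 3 h t - t).
  move=> t; apply: (@continuousB _ _ _ (iter 3 h) id); last exact: cvg_id.
  exact: continuous_iter.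
have [|x xb] := @between_ivt (fun t => iter 3 h t - t) e1 e2 0 h3c.
  move: e1A e2A; rewrite !lohiP /between /= he1 he2.
  case: aeq => -[-> ->]; rewrite ha1 ha2; case: beq => -[-> ->];
  by rewrite hb1 hb2; lra.
move/eqP; rewrite subr_eq0 => /eqP h3x; exists x; split => // hx.
have /AA' := xb; rewrite -alahP => hxA'; rewrite hx in hxA'.
have /AB' := hxA'; rewrite -blbhP => hxB'; rewrite hx in hxB'.
exact: (AB x (A'A _ hxA') (B'B _ hxB')).
Qed.

End Horseshoe.

(** * Periodic orbits without period 3 *)

Section Division.
Variable R : realType.
Implicit Types (g : R -> R) (x w : R).

(** No iterate of g has a point of period 3; quantifying over all iterates makes
    the property pass from g to its iterates. *)
Definition no_period3 g := forall m x, iter (3 * m) g x = x -> iter m g x = x.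

Lemma iter_fixed g x n : g x = x -> iter n g x = x.
Proof. by move=> gx; elim: n => //= n ->. Qed.

Lemma iterC g m n x : iter m g (iter n g x) = iter n g (iter m g x).
Proof. by rewrite -!iterD addnC. Qed.

Lemma iter_mulr_fixed g q x n : iter q g x = x -> iter (n * q) g x = x.
Proof. by move=> gx; rewrite iterM iter_fixed. Qed.

Lemma orbit_reach g w N i j : (0 < N)%N -> iter N g w = w ->
  exists k, iter k g (iter i g w) = iter j g w.
Proof.
move=> N0 gw; exists (j + (i * N - i))%N; rewrite -iterD.
have -> : (j + (i * N - i) + i = j + i * N)%N by nia.
by rewrite iterD iter_mulr_fixed.
Qed.

Lemma finite_argmax (u : nat -> R) (P : nat -> Prop) n :
  (exists2 i, (i < n)%N & P i) ->
  exists i, P i /\ forall j, (j < n)%N -> P j -> u j <= u i.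
Proof.
elim: n => [[]//|n ih [i i_n Pi]].
have [[j j_n Pj]|none] := pselect (exists2 i, (i < n)%N & P i); last first.
  exists i; split=> // j; rewrite ltnS leq_eqVlt => /predU1P[->|j_n] Pj.
    have [-> //|ni] := eqVneq i n.
    by case: none; exists i => //; rewrite ltn_neqAle ni -ltnS.
  by case: none; exists j.
have [|k [Pk kmax]] := ih; first by exists j.
have [[Pn ltn]|nn] := pselect (P n /\ u k < u n).
  exists n; split=> // m; rewrite ltnS leq_eqVlt => /predU1P[->//|m_n] Pm.
  exact: le_trans (kmax _ m_n Pm) (ltW ltn).
exists k; split=> // m; rewrite ltnS leq_eqVlt => /predU1P[->|/kmax//] Pn.
by rewrite leNgt; apply/negP => ltn; apply: nn.
Qed.

Section PeriodicOrbit.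
Variables (g : R -> R) (w : R) (N : nat).
Hypotheses (N_gt0 : (0 < N)%N) (gN : iter N g w = w).

Lemma iter_modn i : iter (i %% N) g w = iter i g w.
Proof.
by rewrite [in RHS](divn_eq i N) addnC iterD iter_mulr_fixed.
Qed.

Lemma orbit_max (P : R -> Prop) : (exists i, P (iter i g w)) ->
  exists i, P (iter i g w) /\
    forall j, P (iter j g w) -> iter j g w <= iter i g w.
Proof.
move=> [i Pi].
have [|k [Pk kmax]] := @finite_argmax (fun i => iter i g w)
    (fun i => P (iter i g w)) N.
  by exists (i %% N)%N; rewrite ?ltn_mod // iter_modn.
exists k; split=> // j Pj.
by rewrite -(iter_modn j); apply: kmax; rewrite ?ltn_mod // iter_modn.
Qed.

Lemma orbit_min (P : R -> Prop) : (exists i, P (iter i g w)) ->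
  exists i, P (iter i g w) /\
    forall j, P (iter j g w) -> iter i g w <= iter j g w.
Proof.
move=> [i Pi].
have [|k [Pk kmin]] := @finite_argmax (fun i => - iter i g w)
    (fun i => P (iter i g w)) N.
  by exists (i %% N)%N; rewrite ?ltn_mod // iter_modn.
exists k; split=> // j Pj.
by rewrite -(iter_modn j) -lerN2; apply: kmin; rewrite ?ltn_mod // iter_modn.
Qed.

Lemma orbit_iter_fixed m i :
  iter m g (iter i g w) = iter i g w -> iter m g w = w.
Proof.
move=> gi; have [k kw] := @orbit_reach g w N i 0 N_gt0 gN.
rewrite /= in kw; rewrite -[in LHS]kw -iterD addnC iterD gi.
exact: kw.
Qed.

(** If the two halves of the orbit were not exchanged, then u and v, the
    adjacent points of the orbit that enclose the fixed point z, would give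
    intervals [u, z] and [z, v] both of whose images under all high iterates
    contain [u, v]. A point and its image on the same side of z supply
    the covering for both parities of the exponent. *)
Lemma division : continuous g -> no_period3 g -> g w <> w ->
  exists z, g z = z /\ forall i,
    iter i g w < z < iter i.+1 g w \/ iter i.+1 g w < z < iter i g w.
Proof.
move=> gc np gw.
have moves i : iter i.+1 g w <> iter i g w.
  by move=> gi; apply: gw; exact: (@orbit_iter_fixed 1 i).
have [iu [u_up u_max]] : exists i, iter i g w < g (iter i g w) /\
    forall j, iter j g w < g (iter j g w) -> iter j g w <= iter i g w.
  apply: (@orbit_max (fun t => t < g t)).
  have [|i [_ imin]] := @orbit_min (fun _ => True); first by exists 0%N.
  by exists i; rewrite lt_neqAle (imin i.+1 I) andbT; apply/eqP => /esym/moves.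
set u := iter iu g w in u_up u_max.
have [iv [uv v_min]] : exists i, u < iter i g w /\
    forall j, u < iter j g w -> iter i g w <= iter j g w.
  by apply: (@orbit_min (fun t => u < t)); exists iu.+1.
set v := iter iv g w in uv v_min.
have v_gu : v <= g u by apply: (v_min iu.+1).
have gv_u : g v <= u.
  rewrite leNgt; apply/negP => /(v_min iv.+1) /=; rewrite -/v le_eqVlt.
  by case/predU1P => [/esym/(moves iv)//|/u_max]; rewrite -/v leNgt uv.
have sides i : iter i g w <= u \/ v <= iter i g w.
  by have [|/v_min] := leP (iter i g w) u; [left|right].
have [||z zb] := @between_ivt R (fun t => g t - t) u v 0.
- by move=> t; apply: (@continuousB _ _ _ g id); [exact: gc|exact: cvg_id].
- by rewrite /between; lra.
move/eqP; rewrite subr_eq0 => /eqP gz.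
have uzv : u < z < v.
  have zu : z != u by apply/eqP => zu; move: gz; rewrite zu => /(moves iu).
  have zv : z != v by apply/eqP => zv; move: gz; rewrite zv => /(moves iv).
  by unfold between in zb; lra.
exists z; split=> // i; apply: contrapT => bad.
(* The point of the orbit and its image that lie on the same side of z. *)
have same : (iter i g w <= u /\ iter i.+1 g w <= u) \/
    (v <= iter i g w /\ v <= iter i.+1 g w).
  have [] := sides i; have [] := sides i.+1 => s1 s2; [by left| | |by right];
    by exfalso; apply: bad; lra.
have cover_all a : exists M0, forall n,
    (exists2 s, between (iter a g w) z s & iter (M0 + n) g s <= u) /\
    (exists2 s, between (iter a g w) z s & v <= iter (M0 + n) g s).
  set e := iter a g w.
  (* One application of g turns a reach to the left into one to the right. *)
  pose P M := exists2 s, between e z s & iter M g s <= u.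
  pose Q M := exists2 s, between e z s & v <= iter M g s.
  have PQ M : P M -> Q M.+1.
    move=> [s se gs].
    have [|t ts gt] := @between_ivt R (iter M g) s z u (continuous_iter gc).
      by rewrite (iter_fixed _ gz) /between; lra.
    by exists t; [unfold between in *; lra|rewrite /= gt].
  have QP M : Q M -> P M.+1.
    move=> [s se gs].
    have [|t ts gt] := @between_ivt R (iter M g) s z v (continuous_iter gc).
      by rewrite (iter_fixed _ gz) /between; lra.
    by exists t; [unfold between in *; lra|rewrite /= gt].
  have [k ke] := @orbit_reach g w N a i N_gt0 gN.
  have ee : between e z e by unfold between; lra.
  have PQk : P k.+1 /\ Q k.+1.
    by case: same => -[s0 s1]; split; [|apply: PQ|apply: QP|];
      exists e => //; rewrite /= ?ke.
  exists k.+1; elim=> [|n [/PQ + /QP]]; first by rewrite addn0.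
  by rewrite addnS.
have [[M1 c1] [M2 c2]] := (cover_all iu, cover_all iv).
have [[x1 x1b gx1] [y1 y1b gy1]] := c1 M2.
have [[x2 x2b gx2] [y2 y2b gy2]] := c2 M1.
rewrite addnC in gx2 gy2; set M := (M1 + M2)%N in gx1 gy1 gx2 gy2.
have not_z t : iter M g t <= u \/ v <= iter M g t -> t <> z.
  by move=> + tz; rewrite tz (iter_fixed _ gz); lra.
have [/eqP x1z /eqP y1z] := (not_z x1 (or_introl gx1), not_z y1 (or_intror gy1)).
rewrite -/u in x1b y1b; rewrite -/v in x2b y2b.
clear - np gc gx1 gy1 gx2 gy2 x1b y1b x2b y2b x1z y1z uzv.
have uv : u <= v by lra.
have [t tb|t tb|t tb1 tb2|x [h3 h1]] := @horseshoe_period3 R (iter M g) x1 y1 x2 y2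
  u v (continuous_iter gc) uv _ _ gx1 gy1 gx2 gy2 _.
- by clear - tb x1b y1b uzv; unfold between in *; lra.
- by clear - tb x2b y2b uzv; unfold between in *; lra.
- by exfalso; clear - tb1 tb2 x1b y1b x2b y2b uzv x1z y1z; unfold between in *; lra.
- by apply: h1; apply: np; rewrite iterM.
Qed.

End PeriodicOrbit.
End Division.

(** * The half of a periodic orbit *)

Section Halves.
Variable R : realType.
Implicit Types (x y t z : R).

(** S is an interval, expressed through one of its points p, hence dense in the
    segment between its bounds. *)
Lemma closed_segment_hull (S C : set R) (p : R) : S p -> has_ubound S ->
    has_lbound S -> (forall s t, S s -> between p s t -> S t) -> closed C ->
  S `<=` C -> forall t, inf S <= t <= sup S -> C t.
Proof.
move=> Sp ubS lbS Sconv Ccl SC t tS.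
have S0 : S !=set0 by exists p.
apply: Ccl; apply: (closureS SC).
have [->|tr] := eqVneq t (sup S); first exact: closure_sup.
have [tl|tl] := eqVneq t (inf S).
  move=> B /nbhs_ballP[e /= e0 eB].
  have [s Ss sl] := inf_adherent e0 (conj S0 lbS).
  exists s; split => //; apply: eB; rewrite /ball /= tl ltr_distl.
  by have := ge_inf lbS Ss; lra.
apply: subset_closure.
have [tp|pt] := leP t p.
  have [|s Ss st] := @inf_lt R S t S0; first by lra.
  by apply: (Sconv s) => //; unfold between; lra.
have [|s Ss st] := @sup_gt R S t S0; first by lra.
by apply: (Sconv s) => //; unfold between; lra.
Qed.

Section PeriodicOrbit.
Variables (g : R -> R) (w : R) (N : nat).
Hypotheses (N_gt0 : (0 < N)%N) (gN : iter N g w = w).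
Hypotheses (gc : continuous g) (np : no_period3 g).

(** Were y sent to z, then, at a time when p and q are back at their places, the
    image of [p, y] would stretch over [p, z], and [p, y] would contain a
    preimage s of q. The k further steps that move q to p stretch both [s, y]
    and [y, q] over [p, z]: a horseshoe. *)
Lemma avoid_fixed_point z p q y M : g z = z -> (exists i, p = iter i g w) ->
  (exists j, q = iter j g w) -> q < z -> p <= y <= q -> iter M g y <> z.
Proof.
move=> gz [i pE] [j qE] qz pyq gy.
pose h := iter (M * N) g.
have hy : h y = z.
  rewrite /h; have -> : (M * N = (M * N - M) + M)%N by nia.
  by rewrite iterD gy iter_fixed.
have hfix k : h (iter k g w) = iter k g w.
  by rewrite /h -iterD addnC iterD iter_mulr_fixed.
have hp : h p = p by rewrite pE.
have hq : h q = q by rewrite qE.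
have [k qp] := @orbit_reach R g w N j i N_gt0 gN.
rewrite -qE -pE in qp.
have [|s sb hs] := @between_ivt R h p y q (continuous_iter gc).
  by rewrite hp hy /between; lra.
have F t : iter (k + M * N) g t = iter k g (h t) by rewrite iterD.
have Fy : iter (k + M * N) g y = z by rewrite F hy iter_fixed.
have Fs : iter (k + M * N) g s = p by rewrite F hs.
have Fq : iter (k + M * N) g q = p by rewrite F hq.
clear - np gc pyq sb Fy Fs Fq qz.
have pz : p <= z by lra.
have [t tb|t tb|||||t tb1 tb2 Ft|x [h3 h1]] :=
  @horseshoe_period3 R (iter (k + M * N) g) s y q y p z (continuous_iter gc) pz.
- by clear - tb sb pyq qz; unfold between in *; lra.
- by clear - tb pyq qz; unfold between in *; lra.
- by rewrite Fs.
- by rewrite Fy.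
- by rewrite Fq.
- by rewrite Fy.
- have ty : t = y by clear - tb1 tb2 sb pyq; unfold between in *; lra.
  by move: Ft; rewrite ty Fy; lra.
- by apply: h1; apply: np; rewrite iterM.
Qed.

(** Let [p, q] be spanned by the part of the orbit on the left of z. Its images
    stay on one side of z, since they never meet z: on the left for even
    iterates, on the right for odd ones. The closed hull of the images under
    the even iterates is the interval wanted. *)
Lemma invariant_half L U : iter 2 g w <> w -> L <= w <= U ->
    (forall t, L <= t <= U -> L <= g t <= U) ->
  exists z l r i, [/\ g z = z, L <= l < r, r <= U, l <= iter i g w <= r &
    forall t, l <= t <= r -> l <= iter 2 g t <= r /\ t <= z <= g t].
Proof.
move=> g2w LwU LU.
have gw : g w <> w by move=> gw; apply: g2w; rewrite /= !gw.
have [z [gz alt]] := division N_gt0 gN gc np gw.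
have flip i : (iter i g w < z -> z < iter i.+1 g w) /\
    (z < iter i g w -> iter i.+1 g w < z).
  by have := alt i; lra.
have [ip [_ p_min]] : exists i, True /\
    forall j, True -> iter i g w <= iter j g w.
  by apply: (orbit_min N_gt0 gN (P := fun _ => True)); exists 0%N.
set p := iter ip g w in p_min.
have pz : p < z by have := alt ip; have := p_min ip.+1 I; rewrite -/p; lra.
have [iq [qz q_max]] : exists i, iter i g w < z /\
    forall j, iter j g w < z -> iter j g w <= iter i g w.
  by apply: (orbit_max N_gt0 gN (P := fun t => t < z)); exists ip.
set q := iter iq g w in qz q_max.
have even_p k : iter (2 * k + ip) g w < z.
  elim: k => [//|k ih]; rewrite mulnS -addnA [(2 + _)%N]/=.
  by have [_] := flip (2 * k + ip).+1; apply; have [] := flip (2 * k + ip)%N; auto.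
have pq : p < q.
  have := q_max _ (even_p 1%N); have := p_min (2 * 1 + ip)%N I.
  rewrite -/q le_eqVlt => /predU1P[pE|]; last by lra.
  have : iter 2 g (iter ip g w) = iter ip g w by rewrite -iterD; exact/esym.
  by move=> /(orbit_iter_fixed N_gt0 gN)/g2w.
have avoid y M : p <= y <= q -> iter M g y <> z.
  by apply: avoid_fixed_point => //; [exists ip|exists iq].
have even_lt m y : p <= y <= q -> iter (2 * m) g y < z.
  move=> ypq; rewrite ltNge; apply/negP => zy.
  have [|t tb] := @between_ivt R (iter (2 * m) g) p y z (continuous_iter gc).
    have := even_p m; rewrite iterD -/p.
    by unfold between; lra.
  by apply: avoid; unfold between in tb; lra.
have odd_gt m y : p <= y <= q -> z < iter (2 * m).+1 g y.
  move=> ypq; rewrite ltNge; apply/negP => zy.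
  have [|t tb] := @between_ivt R (iter (2 * m).+1 g) p y z (continuous_iter gc).
    have [/(_ (even_p m)) + _] := flip (2 * m + ip)%N.
    rewrite -addSn iterD -/p.
    by unfold between; lra.
  by apply: avoid; unfold between in tb; lra.
have through_p m : exists2 y, p <= y <= q & iter (2 * m) g y = p.
  exists (iter (2 * (m * N.-1) + ip) g w).
    have := q_max _ (even_p (m * N.-1)%N); have := p_min (2 * (m * N.-1) + ip)%N I.
    by rewrite -/q; lra.
  rewrite -iterD (_ : 2 * m + (2 * (m * N.-1) + ip) = ip + (2 * m) * N)%N.
    by rewrite iterD iter_mulr_fixed.
  by clear - N_gt0; case: N N_gt0 => //= n _; nia.
pose S := [set t | exists m y, p <= y <= q /\ iter (2 * m) g y = t].
have LUn m t : L <= t <= U -> L <= iter m g t <= U.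
  by elim: m t => //= m ih t tLU; apply/LU/ih.
have pqLU : L <= p /\ q <= U.
  by split; [have := LUn ip w LwU|have := LUn iq w LwU]; rewrite -/p -/q; lra.
have S_LU s : S s -> L <= s <= U.
  by move=> [m [y [ypq <-]]]; apply: LUn; lra.
have Sp : S p by exists 0%N, p; split => //; lra.
have Sq : S q by exists 0%N, q; split => //; lra.
have ubS : has_ubound S by exists U => s /S_LU; lra.
have lbS : has_lbound S by exists L => s /S_LU; lra.
have Sconv s t : S s -> between p s t -> S t.
  move=> [m [y [ypq <-]]]; have [y0 y0pq y0p] := through_p m.
  rewrite -{1}y0p => /(between_ivt (continuous_iter gc))[x xb xt].
  by exists m, x; split=> //; clear - ypq y0pq xb; unfold between in xb; lra.
have hull C := @closed_segment_hull S C p Sp ubS lbS Sconv.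
have g2c : continuous (iter 2 g) := continuous_iter gc.
have infS s : S s -> inf S <= s := ge_inf lbS (x := s).
have supS s : S s -> s <= sup S := fun Ss => ub_le_sup ubS Ss.
exists z, (inf S), (sup S), ip; rewrite -/p; split => //.
- have := infS _ Sp; have := supS _ Sq.
  have : L <= inf S by apply: lb_le_inf; [exists p|move=> s /S_LU; lra].
  by lra.
- by apply: ge_sup; [exists p|move=> s /S_LU; lra].
- by have := infS _ Sp; have := supS _ Sp; lra.
move=> t tS; split.
  have : (iter 2 g @^-1` `[inf S, sup S]) t.
    apply: (hull _ _ _ t tS).
      by have /continuous_closedP/(_ _ (@itv_closed _ _ (inf S) (sup S))) := g2c.
    move=> _ [m [y [ypq <-]]] /=; rewrite in_itv /=.
    have Sg : S (iter 2 g (iter (2 * m) g y)).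
      by exists m.+1, y; rewrite -iterD mulnS.
    by have := infS _ Sg; have := supS _ Sg; rewrite /=; lra.
  by rewrite /= in_itv.
apply/andP; split.
  apply: (hull [set x | x <= z] (@closed_le _ z) _ t tS).
  by move=> _ [m [y [ypq <-]]] /=; apply/ltW/even_lt.
apply: (hull [set x | z <= g x] _ _ t tS).
  by have /continuous_closedP/(_ _ (@closed_ge _ z)) := gc.
by move=> _ [m [y [ypq <-]]] /=; apply/ltW/odd_gt.
Qed.

End PeriodicOrbit.
End Halves.

(** * Trapped intervals around periodic points *)

Section Traps.
Variable R : realType.
Implicit Types (g h : R -> R) (x y t e l r : R).

Lemma continuous_eps h x e : continuous h -> 0 < e ->
  exists d, 0 < d /\ forall t, `|t - x| < d -> `|h t - h x| < e.
Proof.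
move=> hc e0; have /cvgrPdist_lt/(_ _ e0)/nbhs_ballP[d /= d0 dP] := hc x.
exists d; split => // t td; rewrite distrC; apply: dP.
by rewrite /ball /= distrC.
Qed.

Lemma finite_radius (P : nat -> R -> Prop) n :
    (forall i e e', e' <= e -> P i e -> P i e') ->
    (forall i, (i < n)%N -> exists e, 0 < e /\ P i e) ->
  exists e, 0 < e /\ forall i, (i < n)%N -> P i e.
Proof.
move=> Pmono; elim: n => [|n ih] Pex; first by exists 1.
have [|e1 [e1_gt0 P1]] := ih; first by move=> i i_n; apply: Pex; exact: ltnW.
have [e2 [e2_gt0 P2]] := Pex n (ltnSn n).
exists (Num.min e1 e2); split; first by rewrite lt_min e1_gt0.
move=> i; rewrite ltnS leq_eqVlt => /predU1P[->|i_n].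
  by apply: Pmono P2; rewrite ge_min lexx orbT.
by apply: Pmono (P1 _ i_n); rewrite ge_min lexx.
Qed.

Lemma exact_period g x Q : (0 < Q)%N -> iter Q g x = x ->
  exists p s, [/\ (0 < p)%N, Q = (s * p)%N, iter p g x = x &
    forall i j, (i < j < p)%N -> iter i g x <> iter j g x].
Proof.
move=> Q0 gQ.
have ex : exists n, (0 < n)%N && (iter n g x == x).
  by exists Q; rewrite Q0 gQ eqxx.
have [p /andP[p0 /eqP gp] pmin] := ex_minnP ex.
have smaller n : (0 < n < p)%N -> iter n g x <> x.
  move=> /andP[n0 np] gn; have := pmin n.
  by rewrite n0 gn eqxx /= leqNgt np => /(_ isT).
exists p, (Q %/ p)%N; split => //.
  have [m0|m0] := posnP (Q %% p)%N; first by rewrite [LHS](divn_eq Q p) m0 addn0.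
  case: (smaller (Q %% p)%N); first by rewrite m0 ltn_mod.
  by rewrite (iter_modn gp).
move=> i j /andP[ij jp] gij; case: (smaller (p - j + i)%N).
  by clear - ij jp; lia.
by rewrite iterD gij -iterD subnK // ltnW.
Qed.

Variables (a b : R) (F : R -> R).
Hypotheses (Fc : continuous F) (Fab : forall x, a <= F x <= b).

Lemma iter_range n x : (0 < n)%N -> a <= iter n F x <= b.
Proof. by case: n => // n _; exact: Fab. Qed.

(** For the intervals F^i[l, r] and F^j[l, r] this amounts to disjointness of the
    interiors, in a form that speaks of points only. *)
Definition meet_at_most_once l r i j := forall s t s' t',
  l <= s <= r -> l <= t <= r -> l <= s' <= r -> l <= t' <= r ->
  iter i F s = iter j F t -> iter i F s' = iter j F t' ->
  iter i F s = iter i F s'.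

Lemma renormalizationI l r p : l < r -> a <= l -> r <= b -> r - l < b - a ->
    (0 < p)%N -> (forall i j, (i < j < p)%N -> meet_at_most_once l r i j) ->
    (forall t, l <= t <= r -> l <= iter p F t <= r) ->
  renormalization a b F p l r.
Proof.
move=> lr al rb short p0 once inv; split => //.
- split; first by move=> t /=; rewrite !in_itv /=; lra.
  by move=> sub; have := sub a; have := sub b; rewrite /= !in_itv /=; lra.
- apply/trivIsetP => i j /= ip jp; wlog ij : i j ip jp / (i < j)%N => [wl|_].
    rewrite neq_ltn => /orP[ij|ji]; first by apply: wl; rewrite // ltn_eqF.
    by rewrite setIC; apply: wl; rewrite // ltn_eqF.
  rewrite -subset0 => y [yi yj].
  have /nbhs_ballP[e /= e0 eP] : nbhs y
      ((iter i F @` `[l, r]) `&` (iter j F @` `[l, r])).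
    exact: filterI.
  have [|[s slr sE] [t tlr tE]] := eP y; first exact: ballxx.
  have [|[s' slr' sE'] [t' tlr' tE']] := eP (y + e / 2).
    by rewrite /ball /= ltr_distl; lra.
  have := once i j _ s t s' t' slr tlr slr' tlr'.
  by rewrite ij jp sE tE sE' tE' /= => /(_ isT erefl erefl); lra.
- by move=> _ [t tlr <-]; exact: inv.
Qed.

Lemma nested_le (l r : nat -> R) :
    (forall n, l n <= l n.+1 /\ r n.+1 <= r n) ->
  forall m n, (m <= n)%N -> l m <= l n /\ r n <= r m.
Proof.
move=> nest m n /subnK<-; elim: (n - m)%N => [|k ih]; first by rewrite lexx.
by have := nest (k + m)%N; rewrite addSn; lra.
Qed.

Lemma shrinking_renormalizations (l r : nat -> R) (u : nat -> nat) :
    a < b ->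
    (forall n, [/\ l n < r n, a <= l n & r n <= b]) ->
    (forall n, l n <= l n.+1 /\ r n.+1 <= r n) ->
    (forall e, 0 < e -> exists n, r n - l n < e) ->
    (forall n, (0 < u n)%N) ->
    (forall n i j, (i < j < u n)%N -> meet_at_most_once (l n) (r n) i j) ->
    (forall n t, l n <= t <= r n -> l n <= iter (u n) F t <= r n) ->
  infinitely_renormalizable a b F.
Proof.
move=> ab lr nest small u0 once inv.
have [|n0 n0P] := small (b - a); first by rewrite subr_gt0.
exists (fun n => l (n0 + n)%N), (fun n => r (n0 + n)%N), (fun n => u (n0 + n)%N).
split=> [n|n|].
- have [? ? ?] := lr (n0 + n)%N; apply: renormalizationI => //.
    by have := nested_le nest (leq_addr n n0); lra.
  exact: once.
  exact: inv.
- by move=> t /=; rewrite !in_itv /= addnS; have := nest (n0 + n)%N; lra.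
apply/cvgrPdist_lt => e e0; have [N NP] := small e e0.
exists N => // n /= Nn; have Nn' : (N <= n0 + n)%N := leq_trans Nn (leq_addl _ _).
have [? _ _] := lr (n0 + n)%N; rewrite sub0r normrN ger0_norm ?subr_ge0 ?ltW //.
by have := nested_le nest Nn'; lra.
Qed.

(** Near a periodic point disjointness is automatic, since the points of its
    orbit are at a positive distance from each other. *)
Lemma shrinking_traps x p (l r : nat -> R) : a < b -> (0 < p)%N ->
    (forall i j, (i < j < p)%N -> iter i F x <> iter j F x) ->
    (forall n, [/\ l n < r n, a <= l n & r n <= b]) ->
    (forall n, l n <= x <= r n) ->
    (forall n, l n <= l n.+1 /\ r n.+1 <= r n) ->
    (forall e, 0 < e -> exists n, r n - l n < e) ->
    (forall n t, l n <= t <= r n -> l n <= iter p F t <= r n) ->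
  infinitely_renormalizable a b F.
Proof.
move=> ab p0 xper lr lxr nest small inv.
have [d [d0 dP]] : exists d, 0 < d /\ forall i, (i < p)%N ->
    forall j, (j < p)%N -> (i < j)%N -> forall s t, `|s - x| < d ->
    `|t - x| < d -> iter i F s <> iter j F t.
  apply: finite_radius => [i e e' ee' P j jp ij s t sx tx|i ip].
    by apply: P => //; lra.
  apply: finite_radius => [j e e' ee' P ij s t sx tx|j jp].
    by apply: P => //; lra.
  have [ij|ji] := ltnP i j; last by exists 1.
  pose e := `|iter i F x - iter j F x| / 2.
  have e0 : 0 < e.
    rewrite divr_gt0 // normr_gt0 subr_eq0; apply/eqP.
    by apply: xper; rewrite ij.
  have [d1 [d10 d1P]] := continuous_eps x (continuous_iter (n := i) Fc) e0.
  have [d2 [d20 d2P]] := continuous_eps x (continuous_iter (n := j) Fc) e0.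
  exists (Num.min d1 d2); split; first by rewrite lt_min d10.
  move=> _ s t; rewrite !lt_min => /andP[s1 _] /andP[_ t2] st.
  have := d1P _ s1; have := d2P _ t2; rewrite st.
  have := ler_distD (iter j F t) (iter i F x) (iter j F x).
  by rewrite [`|iter i F x - iter j F t|]distrC /e; lra.
have [n0 n0P] := small d d0.
apply: (@shrinking_renormalizations (fun n => l (n0 + n)%N)
  (fun n => r (n0 + n)%N) (fun=> p)) => //= [n|e e0|n i j /andP[ij jp] s t s' t'|n t tb].
- by rewrite addnS.
- have [N NP] := small e e0; exists N.
  by have := nested_le nest (leq_addl n0 N); lra.
- move=> sb tb _ _ st _; exfalso.
  have near_x y : l (n0 + n)%N <= y <= r (n0 + n)%N -> `|y - x| < d.
    have := nested_le nest (leq_addr n n0); have := lxr (n0 + n)%N.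
    by rewrite ltr_distl; lra.
  by apply: (dP i (ltn_trans ij jp) j jp ij s t _ _ st); exact: near_x.
- exact: inv.
Qed.

Hypotheses (ab : a < b) (not_IR : ~ infinitely_renormalizable a b F).

Lemma vanishing_sequence : exists v : nat -> R,
  (forall n, 0 < v n <= 1 /\ v n.+1 <= v n) /\
  forall c e, 0 < e -> exists n, c * v n < e.
Proof.
exists (fun n => n.+1%:R^-1); split=> [n|c e e0].
  rewrite invr_gt0 ltr0n /= invf_le1 ?ltr0n // ler1n; split=> //.
  by rewrite lef_pV2 ?posrE ?ltr0n // ler_nat.
exists (Num.truncn (c / e)).
by rewrite ltr_pdivrMr ?ltr0n // mulrC -ltr_pdivrMr // truncnS_gt.
Qed.

(** If F^Q collapsed an interval onto its periodic end x, then F^p, with p the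
    period of x, would already do so, by induction on Q / p; all shorter
    intervals ending at x would then be trapped. *)
Lemma no_collapse x y Q : (0 < Q)%N -> iter Q F x = x -> a <= y <= b ->
  (forall t, between x y t -> iter Q F t = x) -> y = x.
Proof.
move=> Q0 FQ; have xab : a <= x <= b by rewrite -FQ; exact: iter_range.
have [p [s [p0 -> Fp xper]]] := exact_period Q0 FQ.
clear Q Q0 FQ; move: y; elim: s => [|s ih] y yab flat.
  by apply: (flat y); rewrite /between; lra.
have pflat t : between x y t -> iter p F t = x.
  move=> tb; apply: ih => [|t' t'b]; first exact: iter_range.
  have [|t'' t''b <-] := @between_ivt R (iter p F) x t t' (continuous_iter Fc).
    by rewrite Fp.
  rewrite -iterD addnC -mulSn; apply: flat.
  by clear - tb t''b; unfold between in *; lra.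
apply: contrapT => /eqP yx; apply: not_IR.
have [L [U [LU LUP LUE]]] := sorted_ends x y.
have LUlt : L < U.
  by case: LUE => -[? ?]; subst; move: yx; rewrite neq_lt; lra.
have LUab : a <= L /\ U <= b by case: LUE => -[? ?]; subst; lra.
have LxU : L <= x <= U by case: LUE => -[? ?]; subst; lra.
clear - Fc ab xab p0 Fp xper pflat LUP LUlt LUab LxU.
have [v [vP v_small]] := vanishing_sequence.
have L0 : 0 <= x - L by lra.
have U0 : 0 <= U - x by lra.
have bounds n : (x - L) * v n <= x - L /\ (U - x) * v n <= U - x.
  by have [/andP[_ v1] _] := vP n; split; rewrite ler_piMr.
have pos n : 0 <= (x - L) * v n /\ 0 <= (U - x) * v n.
  by have [/andP[v0 _] _] := vP n; split; rewrite mulr_ge0 // ltW.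
apply: (@shrinking_traps x p (fun n => x - (x - L) * v n)
  (fun n => x + (U - x) * v n)) => // [n|n|n|e e0|n t tb].
- have [/andP[v0 _] _] := vP n.
  have : 0 < (U - L) * v n by rewrite mulr_gt0 // subr_gt0.
  by have := bounds n; split; lra.
- by have := pos n; lra.
- have [_ v1] := vP n; have := ler_wpM2l L0 v1; have := ler_wpM2l U0 v1.
  by lra.
- by have [n nP] := v_small (U - L) e e0; exists n; lra.
rewrite pflat; first by have := pos n; lra.
by rewrite LUP; have := bounds n; lra.
Qed.

End Traps.

(** * Orbits attracted by a periodic point *)

Section AttractedOrbit.
Variable R : realType.
Implicit Types (h : R -> R) (x y t e : R).
Variables (a b : R) (F : R -> R).
Hypotheses (ab : a < b) (Fc : continuous F) (Fab : forall x, a <= F x <= b).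

(** The directions of monotonicity at the two sides of x may differ, as at a
    turning point. *)
Definition locally_monotone h x := exists e, 0 < e /\ forall y t,
  a <= y <= b -> `|y - x| < e -> between x y t -> between (h x) (h y) (h t).

Hypothesis Flm : forall x, a <= x <= b -> locally_monotone F x.

Lemma locally_monotone_iter n x : a <= x <= b -> locally_monotone (iter n F) x.
Proof.
move=> xab; elim: n => [|n [e [e0 eP]]]; first by exists 1.
have Fx : a <= iter n F x <= b by case: n {eP} => // n; exact: iter_range.
have [d [d0 dP]] := Flm Fx.
have [e' [e'0 e'P]] := continuous_eps x (continuous_iter (n := n) Fc) d0.
exists (Num.min e e'); split; first by rewrite lt_min e0.
move=> y t yab; rewrite lt_min => /andP[ye ye'] tb.
apply: dP; [|exact: e'P|exact: eP].
by case: n {eP e'P Fx} => // n; exact: iter_range.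
Qed.

(** With p the period of x, the orbit z_k of y under F^p tends to x too, since
    p divides q and F^p fixes x. By monotonicity on either side of x, the hull
    of x and of all z_k with k at least n is trapped, and it shrinks to x as n
    grows. *)
Lemma attracted_orbit x y q : (0 < q)%N ->
    (forall e, 0 < e -> exists M, forall m, (M <= m)%N ->
      `|iter (m * q) F y - x| < e) ->
    (forall m, iter (m * q) F y <> x) ->
  infinitely_renormalizable a b F.
Proof.
move=> q0 lim away.
have Fx : iter q F x = x.
  apply/eqP; rewrite -subr_eq0 -normr_eq0; apply/eqP; apply/le_anti.
  rewrite normr_ge0 andbT; apply/ler_addgt0Pl => e e0; rewrite addr0.
  have e20 : 0 < e / 2 by lra.
  have [d [d0 dP]] := continuous_eps x (continuous_iter (n := q) Fc) e20.
  have [M1 M1P] := lim d d0; have [M2 M2P] := lim (e / 2) e20.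
  have := dP _ (M1P (M1 + M2)%N (leq_addr _ _)); rewrite -iterD -mulSn.
  have := M2P (M1 + M2).+1 (leqW (leq_addl _ _)).
  have := ler_distD (iter ((M1 + M2).+1 * q) F y) (iter q F x) x.
  by rewrite [`|iter q F x - iter _ F y|]distrC; lra.
have xab : a <= x <= b by rewrite -Fx; exact: iter_range.
have [p [s [p0 qE Fpx xper]]] := exact_period q0 Fx.
have s0 : (0 < s)%N by move: q0; rewrite qE; case: s {qE}.
pose z k := iter (k * p) F y.
have zx k : z k <> x.
  move=> zk; apply: (away k); rewrite qE.
  have -> : (k * (s * p) = (k * s - k) * p + k * p)%N by nia.
  by rewrite iterD -/(z k) zk iter_mulr_fixed.
have z_lim e : 0 < e -> exists M, forall k, (M <= k)%N -> `|z k - x| < e.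
  move=> e0.
  have [||d [d0 dP]] := @finite_radius R (fun i d =>
      forall t, `|t - x| < d -> `|iter (i * p) F t - x| < e) s.
  - by move=> i e1 e2 e21 H t tx; apply: H; lra.
  - move=> i _.
    have [d dP] := continuous_eps x (continuous_iter (n := i * p) Fc) e0.
    by exists d; rewrite iter_mulr_fixed // in dP.
  have [M MP] := lim d d0; exists (M * s)%N => k Mk.
  rewrite /z (divn_eq k s) addnC mulnDl iterD -mulnA -qE.
  apply: dP; first by rewrite ltn_mod.
  by apply: MP; rewrite leq_divRL.
have [e [e0 eP]] := @locally_monotone_iter p x xab.
have [M0 M0P] := z_lim e e0.
have zab k : (0 < k)%N -> a <= z k <= b.
  by move=> k0; apply: iter_range => //; rewrite muln_gt0 k0.
pose H n := [set t | exists2 k, (M0.+1 + n <= k)%N & between x (z k) t].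
have zH n k : (M0.+1 + n <= k)%N -> H n (z k).
  by move=> nk; exists k => //; unfold between; lra.
have xH n : H n x by exists (M0.+1 + n)%N => //; unfold between; lra.
have Hab n t : H n t -> a <= t <= b.
  move=> [k nk tb]; have [] := (zab k _, xab); first by lia.
  by clear - tb; unfold between in tb; lra.
have Hconv n s' t : H n s' -> between x s' t -> H n t.
  move=> [k nk s'b] tb; exists k => //.
  by clear - s'b tb; unfold between in *; lra.
have Hmono n : H n.+1 `<=` H n.
  by move=> t [k nk tb]; exists k => //; move: nk; rewrite addnS; exact: ltnW.
have Hinv n t : H n t -> H n (iter p F t).
  move=> [k nk tb]; exists k.+1; first exact: leqW.
  rewrite /z mulSn iterD -[x in between x _ _]Fpx; apply: eP => //.
    by apply: zab; lia.
  by apply: M0P; lia.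
have ubH n : has_ubound (H n) by exists b => t /Hab; lra.
have lbH n : has_lbound (H n) by exists a => t /Hab; lra.
have Hinf n t : H n t -> inf (H n) <= t := ge_inf (lbH n) (x := t).
have Hsup n t : H n t -> t <= sup (H n) := fun Ht => ub_le_sup (ubH n) Ht.
have H0 n : H n !=set0 by exists x.
apply: (@shrinking_traps R a b F Fc x p (fun n => inf (H n)) (fun n => sup (H n)))
  => // [n|n|n|d d0|n t tH].
- split.
  + have := Hinf n _ (xH n); have := Hsup n _ (xH n).
    have := Hinf n _ (zH n _ (leqnn _)); have := Hsup n _ (zH n _ (leqnn _)).
    have /eqP := zx (M0.+1 + n)%N; clear.
    by lra.
  + by apply: lb_le_inf => // t /Hab; lra.
  + by apply: ge_sup => // t /Hab; lra.
- by rewrite Hinf //= Hsup.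
- split; first by apply: lb_le_inf => // t /Hmono/Hinf.
  by apply: ge_sup => // t /Hmono/Hsup.
- have d30 : 0 < d / 3 by lra.
  have [M MP] := z_lim _ d30; exists M.
  have near_x t : H M t -> x - d / 3 <= t <= x + d / 3.
    move=> [k Mk tb]; have := MP k; rewrite ltr_distl => /(_ _).
    have -> : (M <= k)%N by lia.
    by move=> /(_ isT); clear - tb d30; unfold between in tb; lra.
  have : x - d / 3 <= inf (H M) by apply: lb_le_inf => // t /near_x; lra.
  have : sup (H M) <= x + d / 3 by apply: ge_sup => // t /near_x; lra.
  by lra.
have : (iter p F @^-1` `[inf (H n), sup (H n)]) t.
  apply: (@closed_segment_hull R (H n) _ x) => //.
  - exact: Hconv.
  - by have /continuous_closedP/(_ _ (@itv_closed _ _ (inf (H n)) (sup (H n)))) :=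
      continuous_iter (n := p) Fc.
  by move=> t' /Hinv Ht' /=; rewrite in_itv /= Hinf //= Hsup.
by rewrite /= in_itv.
Qed.

End AttractedOrbit.

(** * Cyclic intervals *)

Section CyclicIntervals.
Variable R : realType.
Implicit Types (h : R -> R) (x y t w l r : R).
Variables (a b : R) (F : R -> R).
Hypotheses (ab : a < b) (Fc : continuous F) (Fab : forall x, a <= F x <= b).
Hypothesis not_IR : ~ infinitely_renormalizable a b F.

(** Comparing all indices that differ modulo q, and not only those below q, makes
    the images of such an interval cyclic again. *)
Definition cyclic_interval q l r := [/\ l < r, a <= l, r <= b,
  forall t, l <= t <= r -> l <= iter q F t <= r &
  forall i e, ~~ (q %| e)%N -> meet_at_most_once F l r i (i + e)].

(** The new interval J contains a half of the orbit of w under F^q and is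
    separated from F^q(J) by a fixed point z of F^q. The only common point that
    F^j(J) and F^(j+e)(J) can have, when e is an odd multiple of q, is F^j(z): a
    larger overlap would be collapsed onto the orbit of z. *)
Lemma cyclic_interval_doubling q l r w N : no_period3 F -> (0 < q)%N ->
    (0 < N)%N -> iter N F w = w -> iter (2 * q) F w <> w ->
    cyclic_interval q l r -> l <= w <= r ->
  exists l' r' i, cyclic_interval (2 * q) l' r' /\ l' <= iter i F w <= r'.
Proof.
move=> np q0 N0 FN F2q [lr al rb inv once] lwr.
pose g := iter q F.
have gE n x : iter n g x = iter (n * q) F x by rewrite iterM.
have gc : continuous g := continuous_iter Fc.
have gnp : no_period3 g by move=> m x; rewrite !gE -mulnA; exact: np.
have [||z [l' [r' [i [gz ll' rr' iw half]]]]] :=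
    @invariant_half R g w N N0 _ gc gnp l r _ lwr inv.
- by rewrite gE mulnC iter_mulr_fixed.
- by rewrite gE.
exists l', r', (i * q)%N; rewrite -gE; split=> //.
have even_odd k t : l' <= t <= r' ->
    l' <= iter (2 * k) g t <= r' /\ iter (2 * k) g t <= z <= iter (2 * k).+1 g t.
  move=> tJ; suff tk : l' <= iter (2 * k) g t <= r' by have [_] := half _ tk.
  elim: k => [//|k ih]; rewrite mulnS iterD.
  by have [] := half _ ih.
split; [by lra|by lra|by lra| |].
  by move=> t tJ; rewrite -gE; have [] := half t tJ.
move=> j e; have [qe|/once oe _] := boolP (q %| e)%N; last first.
  by move=> s t s' t' sJ tJ s'J t'J; apply: oe => //; lra.
have [e' eE] := dvdnP qe; rewrite eE dvdn_pmul2r // => odd_e.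
(* One of the two exponents j and j + e' of g is even, the other odd, so the
   common value lies on both sides of z. *)
have at_z s t : l' <= s <= r' -> l' <= t <= r' ->
    iter j F s = iter (j + e) F t ->
  iter (j * q - j) F (iter j F s) = z /\ l' <= z <= r'.
  move=> sJ tJ st.
  have gs : iter (j * q - j) F (iter j F s) = iter j g s.
    by rewrite gE -iterD subnK // leq_pmulr.
  have gt : iter (j * q - j) F (iter j F s) = iter (j + e') g t.
    by rewrite st gE -iterD; rewrite eE addnA subnK ?leq_pmulr // mulnDl.
  have [j_odd|j_even] := boolP (odd j).
    have [k kE] : exists k, (j + e' = 2 * k)%N.
      by exists ((j + e')./2); clear - j_odd odd_e; lia.
    have [k' kE'] : exists k, (j = (2 * k).+1)%N.
      by exists j./2; clear - j_odd; lia.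
    have := even_odd k t tJ; have := even_odd k' s sJ.
    rewrite -kE -kE' -gs -gt; clear; lra.
  have [k kE] : exists k, (j + e' = (2 * k).+1)%N.
    by exists ((j + e')./2); clear - j_even odd_e; lia.
  have [k' kE'] : exists k, (j = 2 * k)%N.
    by exists j./2; clear - j_even; lia.
  have := even_odd k t tJ; have := even_odd k' s sJ.
  rewrite -kE -kE' -gs -gt; clear; lra.
suff all_z s t : l' <= s <= r' -> l' <= t <= r' ->
    iter j F s = iter (j + e) F t -> iter j F s = iter j F z.
  move=> s t s' t' sJ tJ s'J t'J; rewrite -eE => st st'.
  by rewrite (all_z _ _ sJ tJ st) (all_z _ _ s'J t'J st').
move=> sJ tJ st; have [_ zJ] := at_z _ _ sJ tJ st.
have ez : iter (j + e) F z = iter j F z by rewrite iterD eE -gE (iter_fixed _ gz).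
apply: (@no_collapse R a b F Fc Fab ab not_IR _ _ (j.+1 * q)) => //.
- by rewrite muln_gt0.
- by rewrite iterC -gE (iter_fixed _ gz).
- by case: (j) => [|j']; [rewrite /=; lra|exact: iter_range].
move=> t' t'b.
have [s' s'b s'E] := between_ivt (continuous_iter Fc) t'b.
have s'J : l' <= s' <= r' by clear - s'b sJ zJ; unfold between in s'b; lra.
move: t'b; rewrite st -ez => /(between_ivt (continuous_iter Fc))[u ub uE].
have uJ : l' <= u <= r' by clear - ub tJ zJ; unfold between in ub; lra.
have [+ _] := at_z s' u s'J uJ (etrans s'E (esym uE)).
rewrite s'E => collapse.
have -> : (j.+1 * q = j + q + (j * q - j))%N.
  by rewrite addnC addnA subnK ?leq_pmulr // mulSn addnC.
by rewrite iterD collapse iterD -/g gz.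
Qed.

(** If F^i were constant on J, then so would be a return map of J, which would
    collapse J onto a periodic point. *)
Lemma cyclic_interval_not_constant q l r i : (0 < q)%N ->
    cyclic_interval q l r ->
  exists s t, [/\ l <= s <= r, l <= t <= r & iter i F s <> iter i F t].
Proof.
move=> q0 [lr al rb inv _]; apply: contrapT => const.
have {}const s t : l <= s <= r -> l <= t <= r -> iter i F s = iter i F t.
  by move=> sJ tJ; apply: contrapT => st; apply: const; exists s, t.
pose Q := (i.+1 * q)%N.
have Qi : Q = (Q - i + i)%N by rewrite /Q; clear - q0; nia.
have constQ s t : l <= s <= r -> l <= t <= r -> iter Q F s = iter Q F t.
  by move=> sJ tJ; rewrite Qi !iterD (const s t).
have Qinv t : l <= t <= r -> l <= iter Q F t <= r.
  move=> tJ; rewrite /Q; elim: i.+1 => [//|k ih].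
  by rewrite mulSn iterD; exact: inv.
have lJ : l <= l <= r by lra.
have rJ : l <= r <= r by lra.
have fixQ : iter Q F (iter Q F l) = iter Q F l by apply: constQ => //; exact: Qinv.
have Q0 : (0 < Q)%N by rewrite muln_gt0.
have x_lr := Qinv _ lJ.
have flat y : l <= y <= r -> forall t, between (iter Q F l) y t -> iter Q F t = iter Q F l.
  by move=> yJ t tb; apply: constQ => //; unfold between in tb; lra.
have := no_collapse Fc Fab ab not_IR Q0 fixQ _ (flat _ lJ).
have := no_collapse Fc Fab ab not_IR Q0 fixQ _ (flat _ rJ).
by move=> H1 H2; have := H1 _; have := H2 _; lra.
Qed.

Lemma segment_image h l r : continuous h -> l <= r -> exists l' r',
  (forall t, l <= t <= r -> l' <= h t <= r') /\
  (forall y, l' <= y <= r' -> exists2 t, l <= t <= r & h t = y).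
Proof.
move=> hc lr.
have hcw : {within `[l, r], continuous h} by exact: continuous_subspaceT.
have [x xlr xmax] := EVT_max lr hcw; have [y ylr ymin] := EVT_min lr hcw.
rewrite !in_itv /= in xlr ylr.
exists (h y), (h x); split=> [t tlr|v vb].
  by have := xmax t; have := ymin t; rewrite in_itv /= tlr => -> // ->.
have [|t tb <-] := @between_ivt R h y x v hc; first by rewrite /between; lra.
by exists t => //; unfold between in tb; lra.
Qed.

Lemma cyclic_interval_image q l r i : (0 < q)%N -> cyclic_interval q l r ->
  exists l' r', cyclic_interval q l' r' /\
    (forall t, l <= t <= r -> l' <= iter i F t <= r').
Proof.
move=> q0 cyc; have [s [s' [sJ s'J ss']]] := cyclic_interval_not_constant i q0 cyc.
have [lr al rb inv once] := cyc.
have [l' [r' [sub sur]]] := segment_image (continuous_iter (n := i) Fc) (ltW lr).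
have sb := sub _ sJ; have s'b := sub _ s'J.
have lr' : l' < r' by move/eqP: ss'; rewrite neq_lt; lra.
have range t : l <= t <= r -> a <= iter i F t <= b.
  by case: (i) => [|n]; [rewrite /=; lra|move=> _; exact: iter_range].
exists l', r'; split=> //; split=> //.
- by have [|t /range + <-] := sur l'; lra.
- by have [|t /range + <-] := sur r'; lra.
- by move=> _ /sur[t tJ <-]; rewrite iterC; apply: sub; exact: inv.
move=> j e qe x y x' y'.
move=> /sur[x0 x0J <-] /sur[y0 y0J <-] /sur[x1 x1J <-] /sur[y1 y1J <-].
rewrite -!iterD addnAC.
exact: (once (j + i)%N e qe).
Qed.

Lemma cyclic_interval_meet m n l r l' r' y : cyclic_interval (2 ^ m) l r ->
    cyclic_interval (2 ^ n) l' r' -> l < y < r -> l' < y < r' ->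
  cyclic_interval (2 ^ maxn m n) (Num.max l l') (Num.min r r').
Proof.
move=> [lr al rb inv once] [lr' al' rb' inv' once'] lyr lyr'.
have pow_inv k N u v : (k <= N)%N ->
    (forall t, u <= t <= v -> u <= iter (2 ^ k) F t <= v) ->
    forall t, u <= t <= v -> u <= iter (2 ^ N) F t <= v.
  move=> kN i0 t tb; rewrite -(subnK kN) expnD.
  by elim: (2 ^ (N - k))%N => [//|j ih]; rewrite mulSn iterD; exact: i0.
have maxE t : (Num.max l l' <= t <= Num.min r r') = (l <= t <= r) && (l' <= t <= r').
  by rewrite ge_max le_min; apply/idP/idP; lra.
split.
- by rewrite gt_max !lt_min; lra.
- by rewrite le_max al.
- by rewrite ge_min rb.
- move=> t; rewrite !maxE => /andP[t1 t2].
  by rewrite (pow_inv m) ?leq_maxl //= (pow_inv n) ?leq_maxr.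
move=> i e ndiv s t s' t'; rewrite !maxE.
move=> /andP[s1 s2] /andP[t1 t2] /andP[s1' s2'] /andP[t1' t2'].
have [mn|nm] := leqP m n.
  by apply: (once' i e) => //; move: ndiv; rewrite (maxn_idPr mn).
by apply: (once i e) => //; move: ndiv; rewrite (maxn_idPl (ltnW nm)).
Qed.

Section TurningPoints.
Variables (d : nat) (c : nat -> R).
Hypothesis Fmon : forall l r, a <= l -> l < r -> r <= b ->
  (forall j, (j < d.+2)%N -> ~ (l < c j < r)) -> monotone_on F l r.

Lemma monotone_onE h l r : monotone_on h l r <->
  (forall x y, l <= x <= r -> l <= y <= r -> x <= y -> h x <= h y) \/
  (forall x y, l <= x <= r -> l <= y <= r -> x <= y -> h y <= h x).
Proof.
split=> -[mono|mono]; [left|right|left|right] => x y.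
- by move=> xJ yJ; apply: mono; rewrite in_itv.
- by move=> xJ yJ; apply: mono; rewrite in_itv.
- by rewrite !in_itv; exact: mono.
- by rewrite !in_itv => xJ yJ; exact: mono.
Qed.

Lemma monotone_locally x : a <= x <= b -> locally_monotone a b F x.
Proof.
move=> xab.
have [|i _|e [e0 eP]] := @finite_radius R (fun j e => c j <> x -> e <= `|c j - x|) d.+2.
- by move=> i e e' ee' P /P; lra.
- have [->|cx] := eqVneq (c i) x; first by exists 1.
  by exists `|c i - x|; rewrite normr_gt0 subr_eq0.
exists e; split=> // y t yab yx tb.
have [l [r [lr lrP lrE]]] := sorted_ends x y.
have [E|xy] := eqVneq x y.
  by have -> : t = x; unfold between in *; lra.
have lt_lr : l < r by move: xy; rewrite neq_lt; lra.
have tlr : l <= t <= r by rewrite -lrP.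
have /monotone_onE mono : monotone_on F l r.
  apply: Fmon => //; try by lra.
  move=> j jd cj; have cx : c j <> x by lra.
  have := lt_le_trans yx (eP j jd cx); rewrite ltr_distl.
  by case: (ler0P (c j - x)); case: lrE => -[? ?]; lra.
have lJ : l <= l <= r by lra.
have rJ : l <= r <= r by lra.
have tr : t <= r by lra.
have lt : l <= t by lra.
have : between (F l) (F r) (F t).
  case: mono => mono; have := mono _ _ lJ tlr lt; have := mono _ _ tlr rJ tr;
  by rewrite /between; lra.
by case: lrE => -[-> ->] //; rewrite betweenC.
Qed.

(** Without a turning point inside any of the intervals F^i(J), the return map
    of J is monotone and its square increasing, so that every periodic point in
    J has return period 1 or 2. *)
Lemma cyclic_interval_turning q l r w N : (0 < q)%N -> (0 < N)%N ->
    iter N F w = w -> iter (2 * q) F w <> w -> cyclic_interval q l r ->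
    l <= w <= r ->
  exists2 j, (j < d.+2)%N & exists l' r', cyclic_interval q l' r' /\ l' < c j < r'.
Proof.
move=> q0 N0 FN F2q cyc lwr; apply: contrapT => none.
have [lr al rb inv once] := cyc.
have mono i : monotone_on (iter i F) l r.
  elim: i => [|i /monotone_onE ih]; first by apply/monotone_onE; left.
  have [l' [r' [cyc' sub]]] := cyclic_interval_image i q0 cyc.
  have [lr' al' rb' _ _] := cyc'.
  have /monotone_onE mono' : monotone_on F l' r'.
    by apply: Fmon => // j jd cj; apply: none; exists j => //; exists l', r'.
  apply/monotone_onE; case: ih => ih; case: mono' => mono';
    [left|right|right|left] => x y xJ yJ xy;
    by apply: mono'; [exact: sub|exact: sub|exact: ih].
pose G := iter (2 * q) F.
have Ginv t : l <= t <= r -> l <= G t <= r.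
  by move=> tJ; rewrite /G mul2n -addnn iterD; apply/inv/inv.
have Gmono x y : l <= x <= r -> l <= y <= r -> x <= y -> G x <= G y.
  move=> xJ yJ xy; rewrite /G mul2n -addnn !iterD.
  by have /monotone_onE[m|m] := mono q;
    (apply: (m); [exact: inv|exact: inv|exact: m]).
have Gn n t : l <= t <= r -> l <= iter n G t <= r.
  by move=> tJ; elim: n => //= n; exact: Ginv.
have GN : iter N G w = w by rewrite -iterM mulnC iter_mulr_fixed.
have [wG|Gw|/esym/F2q//] := ltgtP w (G w).
  have up n : w < iter n.+1 G w.
    elim: n => [//|n ih]; rewrite iterS; apply: (lt_le_trans wG).
    by apply: Gmono => //; [exact: Gn|exact: ltW].
  by have := up N.-1; rewrite prednK // GN ltxx.
have down n : iter n.+1 G w < w.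
  elim: n => [//|n ih]; rewrite iterS; apply: le_lt_trans Gw.
  by apply: Gmono => //; [exact: Gn|exact: ltW].
by have := down N.-1; rewrite prednK // GN ltxx.
Qed.

Hypotheses (np : no_period3 F).
Hypothesis periodic : forall k, exists w, iter (2 ^ k) F w = w /\
  forall m, (m < k)%N -> iter (2 ^ m) F w <> w.

Lemma cyclic_interval_orbit n k w : (n < k)%N -> iter (2 ^ k) F w = w ->
    (forall m, (m < k)%N -> iter (2 ^ m) F w <> w) ->
  exists l r i, cyclic_interval (2 ^ n) l r /\ l <= iter i F w <= r.
Proof.
move=> nk Fk Fm; elim: n nk => [|n ih] nk.
  exists a, b, 1%N; split; last exact: Fab.
  by split=> // i e; rewrite expn0 dvd1n.
have [l [r [i [cyc iw]]]] := ih (ltnW nk).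
have k0 : (0 < 2 ^ k)%N by rewrite expn_gt0.
have [|||l' [r' [i' [cyc' iw']]]] :=
    @cyclic_interval_doubling (2 ^ n) l r (iter i F w) (2 ^ k) np _ k0 _ _ cyc iw.
- by rewrite expn_gt0.
- by rewrite iterC Fk.
- by rewrite -expnS => /(orbit_iter_fixed k0 Fk); exact: Fm.
by exists l', r', (i' + i)%N; rewrite expnS iterD.
Qed.

Lemma turning_cyclic_interval n : exists2 j, (j < d.+2)%N &
  exists l r, cyclic_interval (2 ^ n) l r /\ l < c j < r.
Proof.
(* A point of period 2^(n+2) has period 4 under the return map. *)
have [w [Fk Fm]] := periodic n.+2.
have [l [r [i [cyc iw]]]] := cyclic_interval_orbit (leqW (ltnSn n)) Fk Fm.
have k0 : (0 < 2 ^ n.+2)%N by rewrite expn_gt0.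
apply: (@cyclic_interval_turning _ l r (iter i F w) _ _ k0) => //.
- by rewrite expn_gt0.
- by rewrite iterC Fk.
by rewrite -expnS => /(orbit_iter_fixed k0 Fk); exact: Fm.
Qed.

Lemma pigeonhole (P : nat -> nat -> Prop) D :
    (forall n, exists2 j, (j < D)%N & P j n) ->
  exists j, forall m, exists2 n, (m <= n)%N & P j n.
Proof.
move=> ex; apply: contrapT => none.
have {}none j : exists m, forall n, (m <= n)%N -> ~ P j n.
  apply: contrapT => Hj; apply: none; exists j => m.
  by apply: contrapT => Hm; apply: Hj; exists m => n mn Pn; apply: Hm; exists n.
have [M MP] : exists M, forall j n, (j < D)%N -> (M <= n)%N -> ~ P j n.
  elim: D {ex} => [|D [M MP]]; first by exists 0%N.
  have [m mP] := none D; exists (maxn M m) => j n.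
  rewrite ltnS leq_eqVlt geq_max => /predU1P[->|jD] /andP[Mn mn]; first exact: mP.
  exact: MP.
by have [j jD] := ex M; exact: MP.
Qed.

(** Some turning point is interior to cyclic intervals of arbitrarily large
    period. Running intersections of these are nested, and nondegenerate because
    they are neighbourhoods of that point. *)
Lemma nested_cyclic_intervals : exists (l r : nat -> R) (E : nat -> nat),
  [/\ forall n, (n <= E n)%N, forall n, cyclic_interval (2 ^ E n) (l n) (r n) &
    forall n, l n <= l n.+1 /\ r n.+1 <= r n].
Proof.
have [j jP] := pigeonhole turning_cyclic_interval.
have /choice[J JP] m : exists J : nat * (R * R), (m <= J.1)%N /\
    cyclic_interval (2 ^ J.1) J.2.1 J.2.2 /\ J.2.1 < c j < J.2.2.
  by have [n mn [l [r [cyc lcr]]]] := jP m; exists (n, (l, r)).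
pose K := fix K n := if n is n'.+1 then
   (maxn (K n').1 (J n).1,
     (Num.max (K n').2.1 (J n).2.1, Num.min (K n').2.2 (J n).2.2))
   else J 0%N.
have KP n : [/\ (n <= (K n).1)%N, cyclic_interval (2 ^ (K n).1) (K n).2.1 (K n).2.2 &
    (K n).2.1 < c j < (K n).2.2].
  elim: n => [|n [nK Kcyc Kc]]; first by have [? []] := JP 0%N.
  have [nJ [Jcyc Jc]] := JP n.+1; split => /=.
  - by rewrite leq_max nJ orbT.
  - exact: cyclic_interval_meet Kcyc Jcyc Kc Jc.
  - by rewrite gt_max lt_min; lra.
exists (fun n => (K n).2.1), (fun n => (K n).2.2), (fun n => (K n).1).
split=> n; [by have [] := KP n|by have [] := KP n|].
by rewrite /= le_max ge_min !lexx.
Qed.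

End TurningPoints.
End CyclicIntervals.

(** * Limits of nested cyclic intervals *)

Section Convergence.
Variable R : realType.
Implicit Types (x w : R).

(** An orbit that approaches a periodic orbit eventually follows it point by
    point, since the points of the periodic orbit are separated. *)
Lemma near_periodic_orbit (F : R -> R) p x w : continuous F -> (0 < p)%N ->
    iter p F x = x ->
    (forall e, 0 < e -> exists N, forall n, (N <= n)%N ->
      exists k, `|iter n F w - iter k F x| < e) ->
  exists N k, forall e, 0 < e -> exists M, forall m, (M <= m)%N ->
    `|iter (m * p) F (iter N F w) - iter k F x| < e.
Proof.
move=> Fc p0 Fp near.
have [d [d0 dP]] : exists d, 0 < d /\ forall i, (i < p)%N -> forall j,
    (j < p)%N -> iter i F x != iter j F x -> d <= `|iter i F x - iter j F x|.
  apply: finite_radius => [i e e' ee' P j jp /(P j jp)|i _]; first by lra.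
  apply: finite_radius => [j e e' ee' P /P|j _]; first by lra.
  have [_|ij] := eqVneq (iter i F x) (iter j F x); first by exists 1.
  by exists `|iter i F x - iter j F x|; rewrite normr_gt0 subr_eq0.
have sep i j : `|iter i F x - iter j F x| < d -> iter i F x = iter j F x.
  rewrite -(iter_modn Fp i) -(iter_modn Fp j) => lt_d; apply/eqP.
  apply: contraTT lt_d => /(dP _ (ltn_pmod _ p0) _ (ltn_pmod _ p0)).
  by rewrite leNgt.
have d20 : 0 < d / 2 by lra.
have [|i _|e [e0 eP]] := @finite_radius R (fun i e => forall t,
    `|t - iter i F x| < e -> `|F t - F (iter i F x)| < d / 2) p.
- by move=> i e e' ee' P t ti; apply: P; lra.
- exact: continuous_eps.
have {}eP i t : `|t - iter i F x| < e -> `|F t - F (iter i F x)| < d / 2.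
  by rewrite -(iter_modn Fp i); apply: eP; rewrite ltn_mod.
pose mu := Num.min e (d / 2).
have mu0 : 0 < mu by rewrite lt_min e0.
have muE z : (`|z| < mu) = (`|z| < e) && (`|z| < d / 2) by rewrite lt_min.
have [N NP] := near mu mu0; have [k kP] := NP N (leqnn N).
have follow m : `|iter m F (iter N F w) - iter m F (iter k F x)| < mu.
  elim: m => [//|m]; rewrite !iterS -!iterD muE => /andP[/eP + _].
  have [k' k'P] := NP (m.+1 + N)%N (leq_addl _ _).
  move: (k'P); rewrite muE => /andP[_ k'd] md.
  set A := iter (m + N).+1 F w; set B := iter (m + k).+1 F x.
  have AB : `|A - B| < d / 2 := md.
  have AC : `|A - iter k' F x| < d / 2 := k'd.
  rewrite -[F _]/A -[F _ in X in _ - X]/B /B (sep (m + k).+1 k') //.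
  by have := ler_distD A B (iter k' F x); rewrite [`|B - A|]distrC -/B; lra.
exists N, k => eps eps0.
have [|N' N'P] := near (Num.min eps (d / 2)); first by rewrite lt_min eps0.
exists N' => m N'm.
have := follow (m * p)%N; rewrite muE => /andP[_].
rewrite (iterC _ _ k) (iter_mulr_fixed _ Fp).
have [|k'] := N'P (m * p + N)%N; first by nia.
rewrite lt_min -iterD => /andP[near_k' AC] AB; set A := iter (m * p + N) F w.
rewrite -(sep k' k) //.
have := ler_distD A (iter k' F x) (iter k F x).
by rewrite [`|iter k' F x - A|]distrC /A; lra.
Qed.

End Convergence.

Section NestedIntervals.
Variable R : realType.
Implicit Types (x y u v : R).
Variables (a b : R) (F : R -> R).
Hypotheses (ab : a < b) (Fc : continuous F) (Fab : forall x, a <= F x <= b).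
Hypothesis not_IR : ~ infinitely_renormalizable a b F.
Hypothesis Flm : forall x, a <= x <= b -> locally_monotone a b F x.

(** A periodic point on the orbit would lie in three images of a cyclic interval
    of large period. These are nondegenerate intervals, and two of them extend
    to the same side of the point: too large an overlap. *)
Lemma never_periodic (l r : nat -> R) (E : nat -> nat) y m p :
    (forall n, (n <= E n)%N) ->
    (forall n, cyclic_interval a b F (2 ^ E n) (l n) (r n)) ->
    (forall n, l n <= y <= r n) -> (0 < p)%N ->
  iter p F (iter m F y) <> iter m F y.
Proof.
move=> nE cyc lyr p0 Fp; set x := iter m F y in Fp.
pose n := (3 * p)%N; set q := (2 ^ E n)%N.
have q0 : (0 < q)%N by rewrite expn_gt0.
have pq : (3 * p < q)%N by apply: leq_ltn_trans (nE n) _; exact: ltn_expl.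
have [lr al rb inv once] := cyc n.
have xk k : iter (m + k * p) F y = x.
  by rewrite addnC iterD iter_mulr_fixed.
have other k : exists t, l n <= t <= r n /\ iter (m + k * p) F t != x.
  have [s [t [sJ tJ st]]] :=
    cyclic_interval_not_constant ab Fc Fab not_IR (m + k * p) q0 (cyc n).
  have [sx|sx] := eqVneq (iter (m + k * p) F s) x; last by exists s.
  by exists t; split=> //; apply/eqP => tx; apply: st; rewrite sx tx.
have common i k v : (i < k < 3)%N ->
    (exists2 s, l n <= s <= r n & iter (m + i * p) F s = v) ->
    (exists2 t, l n <= t <= r n & iter (m + k * p) F t = v) -> v = x.
  move=> ik [s sJ sE] [t tJ tE].
  have kE : (m + k * p = m + i * p + (k - i) * p)%N.
    by rewrite -addnA -mulnDl subnKC // ltnW //; case/andP: ik.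
  have nd : ~~ (q %| (k - i) * p)%N.
    by apply/negP => /dvdn_leq; clear - ik p0 pq; nia.
  rewrite -sE -(xk i); apply: (once (m + i * p)%N _ nd s t y y) => //.
    by rewrite -kE sE tE.
  by rewrite -kE !xk.
have reach k t v : l n <= t <= r n -> between x (iter (m + k * p) F t) v ->
    exists2 s, l n <= s <= r n & iter (m + k * p) F s = v.
  move=> tJ; rewrite -{1}(xk k) => /(between_ivt (continuous_iter Fc))[s sb sE].
  by exists s => //; have := lyr n; unfold between in sb; lra.
have same i k ti tk : (i < k < 3)%N -> l n <= ti <= r n -> l n <= tk <= r n ->
    let yi := iter (m + i * p) F ti in let yk := iter (m + k * p) F tk in
    (x < yi /\ x < yk) \/ (yi < x /\ yk < x) -> False.
  move=> ik tiJ tkJ /= side.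
  have [v [vi vk vx]] : exists v, [/\ between x (iter (m + i * p) F ti) v,
      between x (iter (m + k * p) F tk) v & v != x].
    set yi := iter _ F ti in side *; set yk := iter _ F tk in side *.
    case: side => -[s1 s2]; [exists (Num.min yi yk)|exists (Num.max yi yk)];
    by case: leP => le_; split; rewrite ?neq_lt /between; lra.
  move/eqP: vx; apply; apply: (common i k) => //; first exact: reach vi.
  exact: reach vk.
have [t0 [t0J /eqP t0x]] := other 0%N.
have [t1 [t1J /eqP t1x]] := other 1%N.
have [t2 [t2J /eqP t2x]] := other 2%N.
have := same 0%N 1%N t0 t1 isT t0J t1J.
have := same 0%N 2%N t0 t2 isT t0J t2J.
have := same 1%N 2%N t1 t2 isT t1J t2J.
move: t0x t1x t2x; clear; move=> /eqP + /eqP + /eqP; rewrite !neq_lt /=.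
by case/orP => h0; case/orP => h1; case/orP => h2; tauto.
Qed.

Section LimitInterval.
Variables (u v : R).
Hypotheses (uv : u < v) (uv_ab : a <= u /\ v <= b).
Hypothesis never : forall y m p, u <= y <= v -> (0 < p)%N ->
  iter p F (iter m F y) <> iter m F y.
Hypothesis once : forall i e, (0 < e)%N -> meet_at_most_once F u v i (i + e).

Lemma iter_ab n y : u <= y <= v -> a <= iter n F y <= b.
Proof.
by case: n => [|n]; [have := uv_ab; rewrite /=; lra|move=> _; exact: iter_range].
Qed.

(** If F^i(s) = F^(i+e)(t), the intervals F^(i+ke)[u, v] form a chain in which
    neighbours share exactly one point, hence they advance in a constant
    direction. The common points then tend to a fixed point of F^e without
    reaching it, against attracted_orbit. *)
Lemma no_overlap i e s t : (0 < e)%N -> u <= s <= v -> u <= t <= v ->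
  iter i F s <> iter (i + e) F t.
Proof.
move=> e0 sJ tJ st; pose y k := iter (k * e) F (iter i F s).
have ys k : y k = iter (i + k * e) F s by rewrite /y -iterD addnC.
have yt k : y k = iter (i + k.+1 * e) F t.
  by rewrite /y st -iterD addnCA -mulSnr.
have yS k : y k.+1 <> y k.
  by rewrite {1}/y mulSn iterD -/(y k) ys; apply: never.
have joint k z : between (y k) (y k.+1) z -> between (y k.+1) (y k.+2) z ->
    z = y k.+1.
  rewrite {1}yt {1}ys => /(between_ivt (continuous_iter Fc))[s' s'b s'E].
  rewrite {1}yt {1}ys => /(between_ivt (continuous_iter Fc))[t' t'b t'E].
  have s'J : u <= s' <= v := between_within tJ sJ s'b.
  have t'J : u <= t' <= v := between_within tJ sJ t'b.
  have kE : (i + k.+2 * e = i + k.+1 * e + e)%N by rewrite -addnA -mulSnr.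
  rewrite -s'E [in RHS]ys.
  apply: (once e0 s'J t'J sJ tJ); first by rewrite -kE s'E t'E.
  by rewrite -kE -yt -ys.
have turn k : (y k < y k.+1 < y k.+2) \/ (y k.+2 < y k.+1 < y k).
  exact: no_turn (yS k) (yS k.+1) (joint k).
have yab k : a <= y k <= b by rewrite ys; exact: iter_ab.
have attracted x : (y @ \oo --> x) -> (forall m, y m <> x) -> False.
  move=> /cvgrPdist_lt lim away; apply: not_IR.
  apply: (attracted_orbit ab Fc Fab Flm e0 (x := x) (y := iter i F s)) => // eps eps0.
  by have [M _ MP] := lim _ eps0; exists M => m /MP; rewrite distrC.
have [y01|y10] := ltP (y 0%N) (y 1%N).
  have up k : y k < y k.+1 by elim: k => // k ih; have := turn k; lra.
  have ubr : has_ubound (range y) by exists b => _ [k _ <-]; have := yab k; lra.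
  apply: (attracted (sup (range y))).
    by apply: nondecreasing_cvgn => //; apply/nondecreasing_seqP => n; exact: ltW.
  move=> m ym; have : y m.+1 <= sup (range y) by apply: ub_le_sup => //; exists m.+1.
  by have := up m; lra.
have down k : y k.+1 < y k.
  by elim: k => [|k ih]; [have := yS 0%N; lra|have := turn k; lra].
have lbr : has_lbound (range y) by exists a => _ [k _ <-]; have := yab k; lra.
apply: (attracted (inf (range y))).
  by apply: nonincreasing_cvgn => //; apply/nonincreasing_seqP => n; exact: ltW.
move=> m ym; have : inf (range y) <= y m.+1 by apply: ge_inf => //; exists m.+1.
by have := down m; lra.
Qed.

(** An approach of the images to a periodic orbit is excluded as well: it would
    make the orbit of the midpoint one of those in attracted_orbit. *)
Lemma limit_interval_wandering : wandering_interval a b F u v.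
Proof.
have sub y : `]u, v[%classic y -> u <= y <= v by rewrite /= in_itv /=; lra.
split => //.
- by move=> y /sub; have := uv_ab; rewrite /= in_itv /=; lra.
- apply/trivIsetP => i j _ _; wlog ij : i j / (i < j)%N => [wl|_].
    rewrite neq_ltn => /orP[ij|ji]; first by apply: wl; rewrite // ltn_eqF.
    by rewrite setIC; apply: wl; rewrite // ltn_eqF.
  rewrite -subset0 => _ [[s /sub sJ <-] [t /sub tJ]].
  rewrite -(subnKC (ltnW ij)) => ts.
  by apply: (@no_overlap i (j - i) s t) => //; rewrite subn_gt0.
move=> p x [p0 xab Fp _] conv.
pose w := (u + v) / 2.
have wuv : `]u, v[%classic w by have := uv; rewrite /= in_itv /= /w; lra.
have [e e0|N [k lim]] := @near_periodic_orbit R F p x w Fc p0 Fp.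
  have [N _ NP] := conv e e0; exists N => n /NP /(_ (iter n F w)).
  by case=> [|_ [k _ <-] ?]; [exists w|exists k].
apply: not_IR; apply: (attracted_orbit ab Fc Fab Flm p0 lim) => m.
rewrite -iterD => wk; apply: (never (y := w) (m := m * p + N) (p := p)) => //.
  exact: sub.
by rewrite wk iterC Fp.
Qed.

End LimitInterval.

(** If the nested intervals shrank to a point, they would themselves show that F
    is infinitely renormalizable; so their intersection [u, v] is nondegenerate,
    and it inherits the separation of its images for all exponents because the
    periods 2^(E n) are unbounded. *)
Lemma nested_cyclic_wandering (l r : nat -> R) (E : nat -> nat) :
    (forall n, (n <= E n)%N) ->
    (forall n, cyclic_interval a b F (2 ^ E n) (l n) (r n)) ->
    (forall n, l n <= l n.+1 /\ r n.+1 <= r n) ->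
  exists u v, wandering_interval a b F u v.
Proof.
move=> nE cyc nest.
have [e [e0 long]] : exists e, 0 < e /\ forall n, e <= r n - l n.
  apply: contrapT => short; apply: not_IR.
  apply: (@shrinking_renormalizations R a b F l r (fun n => 2 ^ E n)%N ab) => //.
  - by move=> n; have [] := cyc n.
  - move=> e e0; apply: contrapT => long; apply: short; exists e; split => // n.
    by rewrite leNgt; apply/negP => lt_e; apply: long; exists n.
  - by move=> n; rewrite expn_gt0.
  - move=> n i j /andP[ij jE]; have [_ _ _ _ once] := cyc n.
    rewrite -(subnKC (ltnW ij)); apply: once; apply/negP => /dvdn_leq.
    by rewrite subn_gt0 ij => /(_ isT); lia.
  - by move=> n t; have [_ _ _ inv _] := cyc n; exact: inv.
have lr m n : l m + e <= r n.
  have [mn|/ltnW nm] := leqP m n.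
    by have := nested_le nest mn; have := long n; lra.
  by have := nested_le nest nm; have := long m; lra.
have l0 : range l !=set0 by exists (l 0%N), 0%N.
have r0 : range r !=set0 by exists (r 0%N), 0%N.
pose u := sup (range l); pose v := inf (range r).
have ur n : u <= r n - e.
  by apply: ge_sup => // _ [m _ <-]; have := lr m n; lra.
have uv : u + e <= v.
  by apply: lb_le_inf => // _ [n _ <-]; have := ur n; lra.
have lu n : l n <= u.
  by apply: ub_le_sup; [exists (r 0%N) => _ [m _ <-]; have := lr m 0%N; lra|exists n].
have vr n : v <= r n.
  by apply: ge_inf; [exists (l 0%N) => _ [m _ <-]; have := lr 0%N m; lra|exists n].
exists u, v; apply: limit_interval_wandering; first by lra.
- by have [_ + + _ _] := cyc 0%N; have := lu 0%N; have := vr 0%N; lra.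
- move=> y m p yJ p0; apply: (never_periodic nE cyc) => // n.
  by have := lu n; have := vr n; lra.
move=> i j j0 s t s' t' sJ tJ s'J t'J.
have [_ _ _ _ once] := cyc j.
have uv_lr y : u <= y <= v -> l j <= y <= r j by have := lu j; have := vr j; lra.
apply: once; try exact: uv_lr.
apply/negP => /dvdn_leq => /(_ j0); apply/negP; rewrite -ltnNge.
by apply: leq_ltn_trans (nE j) _; exact: ltn_expl.
Qed.

End NestedIntervals.

(** * Multimodal maps *)

Section Modal.
Variable R : realType.
Implicit Types (x y t l r : R).
Variables (a b : R) (d : nat) (c : nat -> R) (f : R -> R).
Hypothesis hf : modal a b d c f.

Let lt_ab : a < b.
Proof.
have [_ _ [<- <- c_lt] _ _] := hf.
suff : forall j, (j <= d)%N -> c 0%N < c j.+1 by apply.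
by elim=> [|j ih] jd; [|apply: lt_trans (ih (ltnW jd)) _]; exact: c_lt.
Qed.

(* Precomposing f with the retraction of the line onto [a, b] gives a map that
   is continuous everywhere and agrees with f, together with its iterates, on
   [a, b]. *)
Let clamp x := Num.max a (Num.min b x).

Let clamp_ab x : a <= clamp x <= b.
Proof. by rewrite le_max ge_max ge_min !lexx (ltW lt_ab). Qed.

Let clamp_id x : a <= x <= b -> clamp x = x.
Proof. by move=> /andP[ax xb]; rewrite /clamp min_r // max_r. Qed.

Let F := f \o clamp.

Let F_ab x : a <= F x <= b.
Proof.
have [_ f_ab _ _ _] := hf.
by have := f_ab (clamp x); rewrite !in_itv; apply; exact: clamp_ab.
Qed.

Let F_continuous : continuous F.
Proof.
have [+ _ _ _ _] := hf => /subspace_continuousP fc x.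
apply/cvgrPdist_lt => e e0.
have /fc/cvgrPdist_lt/(_ _ e0) : `[a, b]%classic (clamp x).
  by rewrite /= in_itv; exact: clamp_ab.
rewrite /within /= => /nbhs_ballP[r /= r0 rP].
apply/nbhs_ballP; exists r => //= y; rewrite /ball /= => xy.
apply: rP; last by rewrite /= in_itv; exact: clamp_ab.
apply: le_lt_trans xy.
have clampE z : [\/ z <= a /\ clamp z = a, a <= z <= b /\ clamp z = z |
    b <= z /\ clamp z = b].
  have [za|az] := leP z a.
    by apply: Or31; rewrite /clamp min_r ?max_l // (le_trans za (ltW lt_ab)).
  have [zb|bz] := leP z b; first by apply: Or32; rewrite clamp_id; lra.
  by apply: Or33; rewrite /clamp min_l ?max_r ltW.
have := lt_ab; have := clampE x; have := clampE y.
by case=> -[? ->]; case=> -[? ->] ?; rewrite ler_norml; case: (ger0P (x - y)); lra.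
Qed.

Let iter_F n x : a <= x <= b -> iter n F x = iter n f x.
Proof.
move=> xab; elim: n => //= n <-; rewrite /F /= clamp_id //.
by case: n => // n; exact: F_ab.
Qed.

Let image_F n (A : set R) : A `<=` `[a, b] ->
  iter n F @` A = iter n f @` A.
Proof.
by move=> Aab; apply: eq_imagel => x /Aab; rewrite /= in_itv; exact: iter_F.
Qed.

Lemma lap_of_segment l r : a <= l -> l < r -> r <= b ->
  (forall j, (j < d.+2)%N -> ~ (l < c j < r)) ->
  exists2 j, (j <= d)%N & c j <= l /\ r <= c j.+1.
Proof.
have [_ _ [ca cb _] _ _] := hf; move=> al lr rb none.
have ex : exists j, (j <= d)%N && (c j <= l) by exists 0%N; rewrite ca.
have [j jd|j /andP[jd jl] jmax] := @ex_maxnP _ d ex; first by case/andP: jd.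
exists j => //; split=> //.
have [->|jd'] := eqVneq j d; first by rewrite cb.
have Sjd : (j.+1 <= d)%N by rewrite ltn_neqAle jd' jd.
have ljS : l < c j.+1.
  by rewrite ltNge; apply/negP => cl; have := jmax j.+1; rewrite Sjd cl ltnn; auto.
by rewrite leNgt; apply/negP => cr; apply: (none j.+1); [exact: leqW|rewrite ljS].
Qed.

Let F_monotone l r : a <= l -> l < r -> r <= b ->
  (forall j, (j < d.+2)%N -> ~ (l < c j < r)) -> monotone_on F l r.
Proof.
move=> al lr rb none; have [j jd [cl rc]] := lap_of_segment al lr rb none.
have [_ _ _ /(_ j jd)/monotone_onE mono _] := hf.
apply/monotone_onE; case: mono => mono; [left|right] => x y xJ yJ xy;
  by rewrite /F /= !clamp_id; [apply: mono| |]; lra.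
Qed.

Let IR_F : infinitely_renormalizable a b F -> infinitely_renormalizable a b f.
Proof.
move=> [l [r [u [ren nest small]]]]; exists l, r, u; split=> // n.
have [lr sub u0 triv inv] := ren n; have [sub' _] := sub.
split=> //; last by rewrite -image_F.
rewrite (_ : (fun i => _) = (fun i => (iter i F @` `[l n, r n])°)) //.
by apply/funext => i; rewrite image_F.
Qed.

Let periodic_F n x : periodic_point a b f n x -> periodic_point a b F n x.
Proof.
move=> [n0 xab fx fi]; have xab' : a <= x <= b by move: xab; rewrite in_itv.
by split=> // [|i]; rewrite iter_F //; exact: fi.
Qed.

Let wandering_F u v : wandering_interval a b F u v -> wandering_interval a b f u v.
Proof.
move=> [uv sub triv conv].
have imE : (fun n => iter n f @` `]u, v[) = (fun n => iter n F @` `]u, v[).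
  by apply/funext => n; rewrite image_F.
split; rewrite ?imE // => n x /[dup] xper /periodic_F/conv.
have [_ + _ _] := xper; rewrite in_itv => xab.
suff -> : forward_orbit F x = forward_orbit f x by [].
by apply: eq_imagel => k _; rewrite iter_F.
Qed.

Hypothesis hP : periods a b f = [set (2 ^ k)%N | k in [set: nat]].

Let F_no_period3 : no_period3 F.
Proof.
move=> [//|m] x Fx.
have xab : a <= x <= b by rewrite -Fx; exact: iter_range.
have [p [s [p0 ps Fp distinct]]] := @exact_period R F x (3 * m.+1) isT Fx.
have : periods a b f p.
  exists x; split=> // [|i /andP[i0 ip]]; rewrite -iter_F // => Fi.
  by apply: (distinct 0%N i); rewrite ?i0.
rewrite hP => -[k _ kp].
have : (p %| m.+1)%N.
  have /Gauss_dvdr <- : coprime p 3 by rewrite -kp coprimeXl.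
  by rewrite ps dvdn_mull.
by move=> /dvdnP[m' ->]; rewrite iter_mulr_fixed.
Qed.

Let F_periodic k : exists w, iter (2 ^ k) F w = w /\
  forall m, (m < k)%N -> iter (2 ^ m) F w <> w.
Proof.
have : periods a b f (2 ^ k)%N by rewrite hP; exists k.
move=> [w /periodic_F[_ _ Fk Fi]]; exists w; split=> // m mk; apply: Fi.
by rewrite expn_gt0 ltn_exp2l.
Qed.

Lemma not_renormalizable_wandering : ~ infinitely_renormalizable a b f ->
  exists u v, wandering_interval a b f u v.
Proof.
move=> not_IR; have {}not_IR : ~ infinitely_renormalizable a b F.
  by move/IR_F.
have [l [r [E [nE cyc nest]]]] := nested_cyclic_intervals lt_ab F_continuous F_ab
  not_IR F_monotone F_no_period3 F_periodic.
have [u [v /wandering_F uvW]] := nested_cyclic_wandering lt_ab F_continuous F_ab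
  not_IR (monotone_locally F_monotone) nE cyc nest.
by exists u, v.
Qed.

End Modal.

Theorem theorem2 (R : realType) (a b : R) (d : nat) (c : nat -> R)
    (f : R -> R)
    (hf : modal a b d c f)
    (hP : periods a b f = [set (2 ^ k)%N | k in [set: nat]])
    (hW : ~ exists u v, wandering_interval a b f u v)
    (hpl : ~ exists l r, plateau a b d c f l r)
    (hA : finite_set (periodic_attractors a b f)) :
  infinitely_renormalizable a b f.
Proof.
apply: contrapT => /(not_renormalizable_wandering hf hP); exact: hW.
Qed.
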